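(* Let $(\Sigma^n,\sigma)$ be a compact, connected Riemannian manifold, let $t_0<t_1$ be real numbers and $M=[t_0,t_1]\times\Sigma$. For each $j\in\mathbb{N}\cup\{\infty\}$ let $f_j:[t_0,t_1]\to(0,\infty)$ be continuous and let $g_j=-dt^2+f_j(t)^2\sigma$ be the corresponding warped product Lorentzian metric on $M$. Suppose that $$\int_{t_0}^{t_1}|f_j-f_\infty|\,dt\to 0\quad\text{as } j\to\infty,$$ and that for all $j\in\mathbb{N}$ $$f_j(t)\ge\left(1-\frac1j\right)f_\infty(t)\quad\text{for all } t\in[t_0,t_1].$$ Then the null distances $\hat d_{t,g_j}$, taken with respect to the coordinate time function $t:M\to[t_0,t_1]$, converge uniformly to $\hat d_{t,g_\infty}$ on $M\times M$, i.e. $$\sup_{p,q\in M}\left|\hat d_{t,g_j}(p,q)-\hat d_{t,g_\infty}(p,q)\right|\to 0\quad\text{as } j\to\infty .$$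
   Context: Each $(M,g_j)$ is time oriented so that $\partial_t$ is future directed. A time function on a spacetime $(M,g)$ is a continuous function $\tau:M\to\mathbb{R}$ that is strictly increasing along all future-directed causal curves; here $\tau=t$, the projection of $M=[t_0,t_1]\times\Sigma$ to the first factor. A piecewise causal curve with respect to $g$ is a piecewise smooth curve $\beta:[a,b]\to M$ with a partition $a=s_0<s_1<\dots<s_k=b$ such that on each piece $[s_{i-1},s_i]$ the curve is either future-directed causal or past-directed causal with respect to $g$. Its null length is $$\hat L_{\tau,g}(\beta)=\sum_{i=1}^k|\tau(\beta(s_i))-\tau(\beta(s_{i-1}))|.$$ The null distance between $p,q\in M$ is $$\hat d_{\tau,g}(p,q)=\inf\{\hat L_{\tau,g}(\beta):\beta\text{ is a piecewise causal curve (with respect to } g)\text{ from } p\text{ to } q\}.$$ *)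

(* Defs.v *)
From HB Require Import structures.
From mathcomp Require Import all_boot all_order all_algebra.
From mathcomp Require Import all_classical all_reals all_analysis.

Set Implicit Arguments.
Unset Strict Implicit.
Unset Printing Implicit Defensive.

Import Order.TTheory GRing.Theory Num.Theory.
Import numFieldNormedType.Exports.

Local Open Scope classical_set_scope.
Local Open Scope ring_scope.

(* [C^k] on an open set [U]: for [k > 0], Frechet differentiability at every
   point of [U] together with [C^(k-1)] directional derivatives.  Only used for
   open [U]. *)
Fixpoint Ck (R : realType) (V W : normedModType R) (k : nat) (U : set V)
    (f : V -> W) : Prop :=
  match k with
  | 0%N => forall x, U x -> {for x, continuous f}
  | k'.+1 => (forall x, U x -> differentiable f x) /\
             (forall v, Ck k' U ('D_v f))
  end.

Definition smooth_on (R : realType) (V W : normedModType R) (U : set V)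
    (f : V -> W) : Prop := forall k, Ck k U f.

(* [chart_map] and [chart_inv] are total functions whose values are meaningful
   only on [chart_dom] and on its image respectively. *)
Record chart (R : realType) (n : nat) (S : topologicalType) := Chart {
  chart_dom : set S ;
  chart_map : S -> 'rV[R]_n ;
  chart_inv : 'rV[R]_n -> S ;
  chart_dom_open : open chart_dom ;
  chart_codom_open : open (chart_map @` chart_dom) ;
  chart_mapK : forall x, chart_dom x -> chart_inv (chart_map x) = x ;
  chart_map_cont : forall x, chart_dom x -> {for x, continuous chart_map} ;
  chart_inv_cont : forall y, (chart_map @` chart_dom) y ->
    {for y, continuous chart_inv}
}.

Definition transition (R : realType) (n : nat) (S : topologicalType)
    (c d : chart R n S) : 'rV[R]_n -> 'rV[R]_n :=
  chart_map d \o chart_inv c.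

(* The smooth structure is given by an atlas that need not be maximal. *)
Record smooth_manifold (R : realType) (n : nat) (S : topologicalType) :=
  SmoothManifold {
  manifold_hausdorff : hausdorff_space S ;
  manifold_second_countable : @second_countable S ;
  chart_index : Type ;
  chart_at : chart_index -> chart R n S ;
  chart_cover : forall x, exists i, chart_dom (chart_at i) x ;
  chart_compat : forall i j,
    smooth_on
      (chart_map (chart_at i) @`
         (chart_dom (chart_at i) `&` chart_dom (chart_at j)))
      (transition (chart_at i) (chart_at j))
}.

(* [metric_mx i x] is the Gram matrix of the metric at the point [x] in the
   coordinates of chart [i], meaningful for [x] in the domain of that chart;
   tangent vectors at [x] are handled through their coordinates. *)
Record riemannian_metric (R : realType) (n : nat) (S : topologicalType)
    (A : smooth_manifold R n S) := RiemannianMetric {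
  metric_mx : chart_index A -> S -> 'M[R]_n ;
  metric_form := fun i x (v w : 'rV[R]_n) =>
    (v *m metric_mx i x *m w^T) 0 0 ;
  metric_smooth : forall i,
    smooth_on (chart_map (chart_at i) @` chart_dom (chart_at i))
              (metric_mx i \o chart_inv (chart_at i)) ;
  metric_sym : forall i x, chart_dom (chart_at i) x ->
    forall v w, metric_form i x v w = metric_form i x w v ;
  metric_pos : forall i x, chart_dom (chart_at i) x ->
    forall v, v != 0 -> 0 < metric_form i x v v ;
  metric_change : forall i j x,
    chart_dom (chart_at i) x -> chart_dom (chart_at j) x ->
    forall v w,
      let D u := 'D_u (transition (chart_at i) (chart_at j))
                      (chart_map (chart_at i) x) in
      metric_form i x v w = metric_form j x (D v) (D w)
}.

Definition spacetime (R : realType) (S : topologicalType) (t0 t1 : R) :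
    set (R * S) :=
  [set p | t0 <= p.1 <= t1].

(* A family of bilinear forms on the tangent spaces of [R * S]: in the
   coordinates given by chart [i] of [S], a tangent vector is a pair
   (component along d/dt, coordinates of the component tangent to [S]). *)
Definition spacetime_metric (R : realType) (n : nat) (S : topologicalType)
    (A : smooth_manifold R n S) : Type :=
  chart_index A -> R * S -> R * 'rV[R]_n -> R * 'rV[R]_n -> R.

Definition warped_metric (R : realType) (n : nat) (S : topologicalType)
    (A : smooth_manifold R n S) (sigma : riemannian_metric A) (f : R -> R) :
    spacetime_metric A :=
  fun i p v w =>
    - (v.1 * w.1) + f p.1 ^+ 2 * metric_form sigma i p.2 v.2 w.2.

Definition dt_field (R : realType) (n : nat) : R * 'rV[R]_n := (1, 0).

Section CausalCurves.
Context (R : realType) (n : nat) (S : topologicalType).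
Context (A : smooth_manifold R n S) (g : spacetime_metric A).

Definition causal_vector i p (v : R * 'rV[R]_n) : Prop :=
  v <> (0, 0) /\ g i p v v <= 0.

(* Signature (-, +, ..., +): a causal vector is future directed when its
   product with the future directed field d/dt is negative. *)
Definition future_causal i p (v : R * 'rV[R]_n) : Prop :=
  causal_vector i p v /\ g i p v (dt_field R n) < 0.

Definition past_causal i p (v : R * 'rV[R]_n) : Prop :=
  causal_vector i p v /\ 0 < g i p v (dt_field R n).

Definition smooth_curve (J : set R) (beta : R -> R * S) : Prop :=
  [/\ smooth_on J (fun s => (beta s).1),
      forall s, J s -> {for s, continuous (fun u => (beta u).2)} &
      forall i : chart_index A,
        smooth_on (J `&` [set s | chart_dom (chart_at i) (beta s).2])
                  (fun s => chart_map (chart_at i) (beta s).2)].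

Definition velocity (i : chart_index A) (beta : R -> R * S) (s : R) :
    R * 'rV[R]_n :=
  ('D_1 (fun u => (beta u).1) s,
   'D_1 (fun u => chart_map (chart_at i) (beta u).2) s).

(* [beta] restricted to [[a, b]] is the restriction of a curve that is smooth
   on an open neighbourhood of [[a, b]] and whose velocity satisfies [C] at
   every point of [[a, b]], endpoints included.  As [a < b] in all uses, that
   velocity does not depend on the extension. The extension may leave the
   spacetime through its boundary. *)
Definition smooth_piece
    (C : chart_index A -> R * S -> R * 'rV[R]_n -> Prop)
    (beta : R -> R * S) (a b : R) : Prop :=
  exists (J : set R) (gamma : R -> R * S),
    [/\ open J, `[a, b] `<=` J, smooth_curve J gamma,
        forall s, a <= s <= b -> gamma s = beta s &
        forall s i, a <= s <= b -> chart_dom (chart_at i) (gamma s).2 ->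
          C i (gamma s) (velocity i gamma s)].

(* The curve is [beta] on [[s 0, s k]], with partition [s 0 < ... < s k];
   values of [beta] and [s] beyond these ranges are irrelevant.  Continuity
   holds because consecutive closed pieces share an endpoint. *)
Definition piecewise_causal (M : set (R * S)) (beta : R -> R * S)
    (k : nat) (s : nat -> R) : Prop :=
  [/\ (0 < k)%N,
      forall i, (i < k)%N -> s i < s i.+1,
      forall u, s 0%N <= u <= s k -> M (beta u) &
      forall i, (i < k)%N ->
        smooth_piece future_causal beta (s i) (s i.+1) \/
        smooth_piece past_causal beta (s i) (s i.+1)].

Definition null_length (tau : R * S -> R) (beta : R -> R * S)
    (k : nat) (s : nat -> R) : R :=
  \sum_(i < k) `|tau (beta (s i.+1)) - tau (beta (s i))|.

(* Extended-real infimum: the value is +oo if no curve joins [p] to [q]. *)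
Definition null_dist (M : set (R * S)) (tau : R * S -> R) (p q : R * S) :
    \bar R :=
  ereal_inf [set l | exists (beta : R -> R * S) (k : nat) (s : nat -> R),
    [/\ piecewise_causal M beta k s, beta (s 0%N) = p, beta (s k) = q &
        l = (null_length tau beta k s)%:E]].

End CausalCurves.

(* Main.v *)
Require Import Defs.
From HB Require Import structures.
From mathcomp Require Import all_boot all_order all_algebra.
From mathcomp Require Import all_classical all_reals all_analysis.
From mathcomp Require Import ring lra.

(* The null distance of -dt^2 + h^2 sigma is the length distance of the norm
   max(|dt|, h |dx|): a causal curve satisfies |t'| >= h |x'|, and conversely
   a short piece of any curve is replaced by a null segment followed by a
   zigzag at nearly constant time.  Hence, if h <= phi f with phi >= 1, an
   f-causal piece from time u to time v bounds the null distance of h by the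
   integral of phi over [u, v].

   With phi the constant (1 - 1/j)^-1 this gives
   (1 - 1/j) d_oo <= d_j, and d_oo is bounded by compactness and connectedness.
   With phi = 1 + |f_j - f_oo| / min f_oo, an f_oo-causal curve with N pieces
   costs at most N |f_j - f_oo|_1 / min f_oo more for f_j; N is bounded over the
   pairs of a finite net.  Moving to the net is uniformly cheap although f_j may
   be large at some times, because a small L^1 distance provides, near every
   time, a time at which f_j is at most max f_oo + 1. *)

Set Implicit Arguments.
Unset Strict Implicit.
Unset Printing Implicit Defensive.

Import Order.TTheory GRing.Theory Num.Theory.
Import numFieldNormedType.Exports.

Local Open Scope classical_set_scope.
Local Open Scope ring_scope.

(** * Iterated directional derivatives *)

(** The two maps have the same first-order expansion at [x]; uniqueness of the differential then
    identifies ['d g x] with ['d f x]. *)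
Lemma near_eq_differentiable (R : realType) (V W : normedModType R)
    (f g : V -> W) (x : V) :
  (\near x, f x = g x) -> differentiable f x -> differentiable g x.
Proof.
move=> fg /diff_locallyP[df fE].
have gE : g \o shift x = cst (g x) + 'd f x +o_ 0 id.
  move/eqaddoP : fE => fE; apply/eqaddoP => e e0.
  have nfg : \forall h \near (0 : V), f (h + x) = g (h + x).
    by move: fg; rewrite (near_shift 0 x) subr0.
  near=> h.
  rewrite /= !fctE /= -(nbhs_singleton fg) -(near nfg h)//.
  by near: h; exact: fE.
have dgE := diff_unique df gE.
by apply/diff_locallyP; rewrite dgE.
Unshelve. all: by end_near. Qed.

(** As [U] is open, equality on [U] is equality near each of its points, hence passes to directional
    derivatives and through the induction on [k]. *)
Lemma Ck_ext (R : realType) (V W : normedModType R) k (U : set V)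
    (f g : V -> W) :
  open U -> (forall x, U x -> f x = g x) -> Ck k U f -> Ck k U g.
Proof.
move=> oU.
have nU h1 h2 : (forall x, U x -> h1 x = h2 x :> W) ->
    forall x, U x -> \near x, h1 x = h2 x.
  move=> h12 x Ux; have := open_nbhs_nbhs (conj oU Ux).
  exact: filterS.
elim: k f g => [|k IH] f g fg /=.
  move=> cf x Ux; suff : g @ x --> g x by [].
  rewrite -(fg _ Ux); apply: cvg_trans (cf x Ux).
  exact/near_eq_cvg/nU.
move=> [df Df]; split=> [x Ux|v].
  by apply: near_eq_differentiable (df _ Ux); exact: nU.
apply: IH (Df v) => x Ux; exact/near_eq_derive/nU.
Qed.

(** The difference quotients of both sides agree term by term before the limit is taken. *)
Lemma derive_line (R : realType) (V W : normedModType R) (f : V -> W)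
    (y v : V) (w : R) :
  'D_w (fun s : R => f (y + s *: v)) = (fun s => 'D_(w *: v) f (y + s *: v)).
Proof.
apply/funext => s.
apply: (congr1 (fun F : R -> W => lim (F @ 0^'))).
apply/funext => h /=; congr (_ *: (f _ - _)).
by rewrite scalerDl scalerA addrCA.
Qed.

Lemma continuous_line (R : realType) (V : normedModType R) (y v : V) :
  continuous (fun s : R => y + s *: v).
Proof.
move=> s; apply: (@continuousD _ _ _ (cst y) (fun s : R => s *: v)).
  exact: cst_continuous.
exact: scalel_continuous.
Qed.

Lemma Ck_line (R : realType) (V W : normedModType R) k (U : set V)
    (f : V -> W) (y v : V) :
  Ck k U f -> Ck k ((fun s : R => y + s *: v) @^-1` U)
                 (fun s : R => f (y + s *: v)).
Proof.
have dline s : differentiable (fun s : R => y + s *: v) s.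
  exact: (@differentiableD _ _ _ (cst y) (fun s : R => s *: v)).
elim: k f => [|k IH] f /=.
  move=> cf s Us.
  apply: (@continuous_comp _ _ _ (fun s : R => y + s *: v) f).
    exact: continuous_line.
  exact: (cf (y + s *: v)).
move=> [df Df]; split=> [s Us|w].
  apply: (@differentiable_comp _ _ _ _ (fun s : R => y + s *: v) f) => //.
  exact: df.
by rewrite derive_line; exact: (IH ('D_(w *: v) f) (Df _)).
Qed.

Lemma Ck_cst (R : realType) (V W : normedModType R) k (U : set V) (c : W) :
  Ck k U (cst c).
Proof.
elim: k c => [|k IH] c /=; first by move=> x _; exact: cst_continuous.
split=> // v; rewrite (_ : 'D_v (cst c) = cst 0) //.
by apply/funext => x; rewrite derive_cst.
Qed.

Lemma Ck_id (R : realType) (V : normedModType R) k (U : set V) :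
  Ck k U (id : V -> V).
Proof.
case: k => [|k] /=; first by move=> x _.
split=> // v; rewrite (_ : 'D_v id = cst v); first exact: Ck_cst.
by apply/funext => x; rewrite derive_id.
Qed.

Lemma Ck_affine (R : realType) (V : normedModType R) k (U : set V)
    (f : V -> R) (a c : R) :
  open U -> Ck k U f -> Ck k U (fun x => a + c * f x).
Proof.
(* The offset [a] is generalized because differentiation replaces it by 0. *)
move=> oU; elim: k f a => [|k IH] f a /=.
  move=> cf x Ux.
  apply: (@continuousD _ _ _ (cst a) (fun x => c * f x)).
    exact: cst_continuous.
  apply: (@continuousM _ _ (cst c) f); first exact: cst_continuous.
  exact: cf.
move=> [df Df]; split=> [x Ux|v].
  apply: (@differentiableD _ _ _ (cst a) (c \*: f)) => //.
  exact/differentiableZ/df.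
apply: (@Ck_ext _ _ _ _ _ (fun x => 0 + c * 'D_v f x)) => // [x Ux|].
  have dfv : derivable f x v by apply: diff_derivable; exact: df.
  rewrite (deriveD (f := cst a) (g := c \*: f)) ?derive_cst ?deriveZ //.
  exact: derivableZ.
exact: IH.
Qed.

(** * Chains of causal pieces *)

Section Chains.
Context (R : realType) (n : nat) (S : topologicalType).
Context (A : smooth_manifold R n S).
Implicit Types (C : chart_index A -> R * S -> R * 'rV[R]_n -> Prop).

Lemma smooth_piece_ext C (beta beta' : R -> R * S) (a b : R) :
  (forall u, a <= u <= b -> beta u = beta' u) ->
  smooth_piece C beta a b -> smooth_piece C beta' a b.
Proof.
move=> bb [J [gam [oJ abJ sJ gb Cg]]]; exists J, gam; split=> // s ab.
by rewrite gb// bb.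
Qed.

(** Translating the parameter lets a piece start where the previous one ends, as concatenation
    requires. *)
Lemma smooth_piece_shift C (beta : R -> R * S) (a b c : R) :
  smooth_piece C beta a b ->
  smooth_piece C (fun u => beta (c + u)) (a - c) (b - c).
Proof.
move=> [J [gam [oJ abJ [s1 s2 s3] gb Cg]]].
have lineE : (fun s : R => c + s *: (1 : R)) = (fun s => c + s).
  by apply/funext => s; rewrite scaler1.
have fE (W : normedModType R) (f : R -> W) :
    (fun s : R => f (c + s *: (1 : R))) = (fun s => f (c + s)).
  by apply/funext => s; rewrite scaler1.
have cc : continuous (fun s : R => c + s).
  by rewrite -lineE; exact: continuous_line.
have Dc (W : normedModType R) (f : R -> W) s :
    'D_1 (fun u => f (c + u)) s = 'D_1 f (c + s).
  have /(congr1 (fun h => h s)) /= := derive_line f c (1 : R) 1.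
  by rewrite fE !scaler1.
have Ckc (W : normedModType R) k U (f : R -> W) :
    Ck k U f -> Ck k ((fun s => c + s) @^-1` U) (fun s => f (c + s)).
  by move=> /(Ck_line c 1); rewrite lineE fE.
have shab s : a - c <= s <= b - c -> a <= c + s <= b by lra.
exists ((fun s => c + s) @^-1` J), (fun u => gam (c + u)); split.
- by apply: open_comp => // *; exact: cc.
- by move=> s /=; rewrite in_itv /= => /shab sab; apply: abJ; rewrite /= in_itv.
- split=> [k|s Js|i k].
  + exact: (Ckc _ _ _ (fun u => (gam u).1)).
  + apply: (@continuous_comp _ _ _ (fun s => c + s) (fun u => (gam u).2)).
      exact: cc.
    exact: s2.
  + exact: (Ckc _ _ _ (fun u => chart_map (chart_at i) (gam u).2) (s3 i k)).
- by move=> s /shab; exact: gb.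
- move=> s i /shab sab dg; have := Cg _ i sab dg; congr (C _ _ _).
  rewrite /velocity (Dc _ (fun u => (gam u).1)).
  by rewrite (Dc _ (fun u => chart_map (chart_at i) (gam u).2)).
Qed.

Context (g : spacetime_metric A) (M : set (R * S)).

Definition causal_piece (beta : R -> R * S) (a b : R) :=
  smooth_piece (future_causal g) beta a b \/
  smooth_piece (past_causal g) beta a b.

Definition causal_step (p q : R * S) :=
  exists beta a b, [/\ a < b, forall u, a <= u <= b -> M (beta u),
    causal_piece beta a b, beta a = p & beta b = q].

Context (tau : R * S -> R).

(** Each step keeps its own parametrization, so that concatenation and induction over the pieces
    need no common partition; [curve_chain] and [chain_curve] translate to and from piecewise causal
    curves. *)
Inductive causal_chain (p : R * S) : R * S -> R -> Prop :=
| chain_step q : causal_step p q -> causal_chain p q `|tau q - tau p|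
| chain_rcons q r l : causal_chain p q l -> causal_step q r ->
    causal_chain p r (l + `|tau r - tau q|).

Lemma causal_chain_ge0 p q l : causal_chain p q l -> 0 <= l.
Proof. by elim=> // *; rewrite addr_ge0. Qed.

Lemma causal_chain_cat p q r l l' :
  causal_chain p q l -> causal_chain q r l' -> causal_chain p r (l + l').
Proof.
move=> pq; elim=> [r' qr|r' r'' l'' _ IH st]; first exact: chain_rcons pq qr.
by rewrite addrA; exact: chain_rcons IH st.
Qed.

Lemma curve_chain beta k s : piecewise_causal g M beta k s ->
  causal_chain (beta (s 0%N)) (beta (s k)) (null_length tau beta k s).
Proof.
move=> [k0 ss Mb pc].
have step i : (i < k)%N -> causal_step (beta (s i)) (beta (s i.+1)).
  move=> ik; exists beta, (s i), (s i.+1); split=> //; [exact: ss| |exact: pc].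
  move=> u /andP[u1 u2]; apply: (Mb); apply/andP; split.
    apply: le_trans u1; elim: i ik {u2} => // i IH ik.
    by apply: le_trans (IH (ltnW ik)) _; apply/ltW/ss; exact: ltnW.
  apply: (le_trans u2); have := ik; move: (i.+1) => j {ik u1 u2}.
  elim: k ss {k0 pc Mb} => [|k IH] ss; first by rewrite leqn0 => /eqP ->.
  rewrite leq_eqVlt => /orP[/eqP -> //|jk].
  apply: le_trans (IH _ jk) _; first by move=> i' ik'; apply: ss; exact: ltnW.
  exact/ltW/ss.
rewrite /null_length; elim: k k0 step {ss Mb pc} => // -[_ _ step|k IH _ step].
  by rewrite big_ord1; apply/chain_step/step.
rewrite big_ord_recr /=; apply: chain_rcons; last exact: step.
by apply: IH => // i ik; apply: step; exact: ltnW.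
Qed.

Lemma chain_curve p q l : causal_chain p q l ->
  exists (beta : R -> R * S) (k : nat) (s : nat -> R),
    [/\ piecewise_causal g M beta k s, beta (s 0%N) = p, beta (s k) = q &
        l = null_length tau beta k s].
Proof.
elim=> {q l} [q [beta [a [b [ab Mb pc <- <-]]]]|q r l _].
  exists beta, 1%N, (fun i => if i is 0%N then a else b); split=> //.
    by split=> // -[|//].
  by rewrite /null_length big_ord1.
move=> [beta [k [s [[k0 ss Mb pc] bp bq ->]]]].
move=> [gam [a [b [ab Mg pg ga gb]]]].
(* The partition gets one more node, and the new piece is translated to start at [s k]; the two
   definitions of [beta'] agree there because both curves pass through [q]. *)
pose s' i := if (i <= k)%N then s i else s k + (b - a).
pose beta' u := if u <= s k then beta u else gam (a - s k + u).
have s'k i : (i <= k)%N -> s' i = s i by rewrite /s' => ->.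
have s'k1 : s' k.+1 = s k + (b - a) by rewrite /s' ltnn.
have s'S i : (i < k.+1)%N -> s' i < s' i.+1.
  rewrite ltnS leq_eqVlt => /orP[/eqP ->|ik].
    by rewrite s'k1 s'k// ltrDl subr_gt0.
  by rewrite !s'k ?(ltnW ik)//; exact: ss.
have bl u : u <= s k -> beta' u = beta u by rewrite /beta' => ->.
have br u : s k <= u -> beta' u = gam (a - s k + u).
  rewrite /beta' le_eqVlt => /orP[/eqP <-|]; last by rewrite ltNge => /negbTE ->.
  by rewrite lexx subrK ga.
have smono i j : (i <= j <= k)%N -> s i <= s j.
  move=> /andP[+ jk]; elim: j jk => [_|j IH jk]; first by rewrite leqn0 => /eqP ->.
  rewrite leq_eqVlt => /orP[/eqP -> //|ij].
  by apply: le_trans (IH (ltnW jk) ij) _; exact/ltW/ss.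
exists beta', k.+1, s'; split.
- split=> // [u|i].
    rewrite s'k// s'k1 => /andP[u0 uk]; have [usk|/ltW sku] := leP u (s k).
      by rewrite bl//; apply: Mb; rewrite u0.
    by rewrite br//; apply: Mg; lra.
  rewrite ltnS leq_eqVlt => /orP[/eqP ->|ik].
    rewrite s'k1 s'k//.
    have pe : forall u, s k <= u <= s k + (b - a) -> gam (a - s k + u) = beta' u.
      by move=> u /andP[u1 _]; rewrite br.
    have E1 : s k = a - (a - s k) by ring.
    have E2 : s k + (b - a) = b - (a - s k) by ring.
    by case: pg => pg; [left|right]; apply: (smooth_piece_ext pe);
      rewrite E2 {2}E1; exact: smooth_piece_shift.
  rewrite !s'k ?(ltnW ik)//.
  have pe : forall u, s i <= u <= s i.+1 -> beta u = beta' u.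
    move=> u /andP[_ u2]; rewrite bl//; apply: (le_trans u2).
    by apply: smono; rewrite ik leqnn.
  by case: (pc _ ik) => pi; [left|right]; exact: (smooth_piece_ext pe).
- by rewrite s'k// bl//; apply: smono; rewrite leqnn.
- by rewrite s'k1 br ?lerDl ?subr_ge0 1?ltW// -gb; congr gam; ring.
- rewrite /null_length big_ord_recr /=; congr (_ + `|tau _ - tau _|).
  + apply: eq_bigr => i _; have ik := ltn_ord i.
    by rewrite !s'k ?(ltnW ik)// !bl//; apply: smono; rewrite ?ik ?(ltnW ik) leqnn.
  + by rewrite s'k1 br ?lerDl ?subr_ge0 1?ltW// -gb; congr gam; ring.
  + by rewrite s'k// bl.
Qed.

Local Open Scope ereal_scope.
Local Notation nd := (null_dist g M tau).

Lemma null_dist_le_chain p q l : causal_chain p q l -> nd p q <= l%:E.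
Proof.
move=> /chain_curve[beta [k [s [pc bp bq ->]]]]; apply: ereal_inf_lbound.
by exists beta, k, s.
Qed.

Lemma le_null_dist p q x : (forall l, causal_chain p q l -> x <= l%:E) ->
  x <= nd p q.
Proof.
move=> H; apply: le_ereal_inf_tmp => _ [beta [k [s [pc bp bq ->]]]].
by apply: H; rewrite -bp -bq; exact: curve_chain.
Qed.

Lemma null_dist_ge0 p q : 0 <= nd p q.
Proof.
by apply: le_null_dist => l /causal_chain_ge0; rewrite lee_fin.
Qed.

Lemma null_dist_triangle q p r : nd p r <= nd p q + nd q r.
Proof.
(* An infinite first term makes the right-hand side infinite, since the second term is nonnegative.
   Otherwise it can be subtracted, and the bound is checked on chains for each infimum in turn. *)
have [->|pq] := eqVneq (nd p q) +oo.
  by rewrite addye ?leey// gt_eqF// (lt_le_trans _ (null_dist_ge0 _ _)).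
have fpq : nd p q \is a fin_num by rewrite ge0_fin_numE ?null_dist_ge0 ?ltey.
rewrite addeC -leeBlDr//; apply: le_null_dist => l qr.
rewrite leeBlDr// addeC -leeBlDr//; apply: le_null_dist => l' pq'.
rewrite leeBlDr// -EFinD; apply: null_dist_le_chain.
exact: causal_chain_cat pq' qr.
Qed.

Lemma null_dist_step p q : causal_step p q -> nd p q <= `|tau q - tau p|%:E.
Proof. by move=> /chain_step/null_dist_le_chain. Qed.

End Chains.

(** * Causal curves of warped products *)

Section Warped.
Context (R : realType) (n : nat) (S : topologicalType).
Context (A : smooth_manifold R n S) (sigma : riemannian_metric A).
Context (t0 t1 : R).
Implicit Types (J : set R) (gam : R -> R * S) (h : R -> R).

Local Notation M := (@spacetime R S t0 t1).
Local Notation nd h := (null_dist (warped_metric sigma h) M fst).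

Definition tder gam (s : R) : R := 'D_1 (fun u => (gam u).1) s.

Definition speed2 (i : chart_index A) gam (s : R) : R :=
  let v := (velocity i gam s).2 in metric_form sigma i (gam s).2 v v.

(* The first component of [gam] is the time along future directed pieces, and
   the opposite of the time along past directed ones. *)
Definition rising J gam (a b : R) : Prop :=
  [/\ open J, `[a, b] `<=` J, smooth_curve A J gam &
      forall s, a <= s <= b -> 0 < tder gam s].

Lemma rising_sub J gam a b u v : a <= u -> v <= b ->
  rising J gam a b -> rising J gam u v.
Proof.
move=> au vb [oJ abJ sJ d0]; split=> // [s|s uv].
  by rewrite /= in_itv /= => uv; apply: abJ; rewrite /= in_itv /=; lra.
by apply: d0; lra.
Qed.

Lemma rising_differentiable J gam a b s : rising J gam a b -> a <= s <= b ->
  differentiable (fun u => (gam u).1) s.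
Proof.
move=> [oJ abJ [sJ _ _] d0] ab.
have [+ _] := sJ 1%N; apply; apply: abJ.
by rewrite /= in_itv.
Qed.

Lemma rising_continuous J gam a b : rising J gam a b ->
  {within `[a, b], continuous (fun u => (gam u).1)}.
Proof.
move=> rg; apply: derivable_within_continuous => s; rewrite in_itv /= => ab.
by apply: diff_derivable; exact: (rising_differentiable rg).
Qed.

Lemma rising_lt J gam a b : rising J gam a b ->
  forall u v, a <= u -> u < v -> v <= b -> (gam u).1 < (gam v).1.
Proof.
move=> rg u v au uv vb.
apply: (@gtr0_derive1_lt_cc R (fun u => (gam u).1) a b) => //.
- move=> x; rewrite in_itv /= => ab.
  by apply: diff_derivable; apply: (rising_differentiable rg); lra.
- move=> x; rewrite in_itv /= => ab; rewrite derive1E.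
  by case: rg => _ _ _; apply; lra.
- exact: rising_continuous rg.
- by rewrite in_itv /=; lra.
- by rewrite in_itv /=; lra.
Qed.

Lemma rising_le J gam a b : rising J gam a b ->
  forall u v, a <= u -> u <= v -> v <= b -> (gam u).1 <= (gam v).1.
Proof.
move=> rg u v au; rewrite le_eqVlt => /orP[/eqP -> //|uv vb].
exact/ltW/(rising_lt rg).
Qed.

Lemma rising_IVT J gam a b u v y : rising J gam a b -> a <= u -> u <= v ->
  v <= b -> (gam u).1 < y < (gam v).1 ->
  exists c, [/\ u < c, c < v & (gam c).1 = y].
Proof.
move=> rg au uv vb /andP[y1 y2].
have rg' := rising_sub au vb rg.
have [|c] := @IVT R (fun u => (gam u).1) u v y uv (rising_continuous rg').
  by rewrite ge_min le_max (ltW y1) (ltW y2) orbT.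
rewrite in_itv /= => /andP[uc cv] cy; exists c; split=> //.
  by rewrite lt_neqAle uc andbT; apply/eqP => E; move: y1; rewrite E cy ltxx.
by rewrite lt_neqAle cv andbT; apply/eqP => E; move: y2; rewrite -E cy ltxx.
Qed.

Lemma metric_form0r i x v : metric_form sigma i x v 0 = 0.
Proof. by rewrite /metric_form trmx0 mulmx0 mxE. Qed.

(** The spatial path of [gam] is kept, while its clock runs [k] times as fast, forwards for [e = 1]
    and backwards for [e = -1]. The new time derivative is [e * k * tder gam s], so the last
    hypothesis says that the new velocity is causal. *)
Lemma warped_step h J gam a b (e k t : R) :
  rising J gam a b -> a < b -> 0 < k -> e = 1 \/ e = -1 ->
  let c s := t + e * k * ((gam s).1 - (gam a).1) in
  (forall s, a <= s <= b -> t0 <= c s <= t1) ->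
  (forall s i, a <= s <= b -> chart_dom (chart_at i) (gam s).2 ->
     h (c s) ^+ 2 * speed2 i gam s <= (k * tder gam s) ^+ 2) ->
  causal_step (warped_metric sigma h) M (t, (gam a).2) (c b, (gam b).2).
Proof.
move=> rg ab k0 e1 c cM hk; have [oJ abJ [s1 s2 s3] d0] := rg.
pose beta s := (c s, (gam s).2).
have c1 s : c s = (t - e * k * (gam a).1) + e * k * (gam s).1.
  by rewrite /c; ring.
have Db s : a <= s <= b -> 'D_1 c s = e * k * tder gam s.
  move=> sab; rewrite (_ : c =
      (cst (t - e * k * (gam a).1) + (e * k) \*: (fun u => (gam u).1))).
    have dg : derivable (fun u => (gam u).1) s 1.
      by apply: diff_derivable; exact: (rising_differentiable rg).
    rewrite (deriveD (f := cst _) (g := _ \*: _)) //.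
      by rewrite derive_cst add0r deriveZ.
    exact: derivableZ.
  by apply/funext => u; rewrite c1.
have e2 : e ^+ 2 = 1 by case: e1 => ->; rewrite ?sqrrN expr1n.
have causal s i : a <= s <= b -> chart_dom (chart_at i) (beta s).2 ->
    causal_vector (warped_metric sigma h) i (beta s) (velocity i beta s).
  move=> sab dom; have ds := d0 _ sab; split.
    move=> [E _]; move: E; rewrite (Db _ sab) => /eqP.
    rewrite !mulf_eq0 (gt_eqF ds) (gt_eqF k0) !orbF.
    by case: e1 => ->; rewrite ?oppr_eq0 oner_eq0.
  rewrite /warped_metric /= (Db _ sab).
  have := hk s i sab dom.
  rewrite /speed2 /= addrC subr_le0 => /le_trans; apply.
  by rewrite -expr2 -mulrA [leRHS]exprMn e2 mul1r.
exists beta, a, b; split=> //.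
- have sb : smooth_curve A J beta.
    split=> // m; rewrite (_ : (fun s => (beta s).1) =
        (fun s => (t - e * k * (gam a).1) + e * k * (gam s).1)).
      by apply: Ck_affine.
    by apply/funext => s; rewrite /beta /= c1.
  have [E|E] := e1; [left|right]; exists J, beta; split=> // s i sab dom;
    (split; first exact: causal);
    rewrite /warped_metric /= metric_form0r mulr0 addr0 mulr1 (Db _ sab) E;
    have := mulr_gt0 k0 (d0 _ sab); lra.
- by rewrite /beta /c subrr mulr0 addr0.
Qed.

(* Zigzag between times [w1] and [w2], going up and then down by the same
   amount while following the spatial component of [gam]. *)
Lemma warped_horizontal h J gam a b (k w1 w2 t : R) :
  rising J gam a b -> a < b -> 0 < k ->
  t0 <= w1 -> w1 < w2 -> w2 <= t1 -> w1 <= t <= w2 ->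
  (forall s i r, a <= s <= b -> w1 <= r <= w2 ->
     chart_dom (chart_at i) (gam s).2 ->
     h r ^+ 2 * speed2 i gam s <= (k * tder gam s) ^+ 2) ->
  (nd h (t, (gam a).2) (t, (gam b).2) <= (k * ((gam b).1 - (gam a).1))%:E)%E.
Proof.
move=> rg ab k0 tw1 w12 wt2 wt hk; pose T s := (gam s).1.
(* One leg of the zigzag: a single causal piece whose time changes by [k * (T v - T u)] in the
   direction [e]. *)
have step u v e t' : a <= u -> u < v -> v <= b -> e = 1 \/ e = -1 ->
    w1 <= t' <= w2 -> w1 <= t' + e * k * (T v - T u) <= w2 ->
    (nd h (t', (gam u).2) ((t' + e * k * (T v - T u))%R, (gam v).2) <=
       (k * (T v - T u))%:E)%E.
  move=> au uv vb e1 wt' wv.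
  have cW s : u <= s <= v -> w1 <= t' + e * k * (T s - T u) <= w2.
    move=> /andP[us sv]; have := rising_le rg au us (le_trans sv vb).
    have := rising_le rg (le_trans au us) sv vb; rewrite -/(T u) -/(T s) -/(T v).
    move=> /(ler_wpM2l (ltW k0)) q1 /(ler_wpM2l (ltW k0)) q2.
    by case: e1 wv => ->; lra.
  have /null_dist_step : causal_step (warped_metric sigma h) M
     (t', (gam u).2) (t' + e * k * (T v - T u), (gam v).2).
    apply: (warped_step (J := J)) => //.
    - exact: rising_sub rg.
    - by move=> s /cW; rewrite -/(T s) -/(T u); lra.
    - by move=> s i uv' dom; apply: hk => //; [lra|exact: cW].
  move=> /(_ fst)/le_trans; apply.
  rewrite lee_fin /= addrC addKr; have := rising_lt rg au uv vb.
  rewrite -/(T u) -/(T v) -subr_gt0 => Tuv.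
  rewrite normrM normrM (gtr0_norm k0) (gtr0_norm Tuv).
  by case: e1 => ->; rewrite ?normrN normr1 mul1r.
(* One tooth of the zigzag: [c] halves the increase of [T], so the legs in directions [e] and [- e]
   cancel and the time returns to [t]. *)
have base u v : a <= u -> u < v -> v <= b -> k * (T v - T u) <= w2 - w1 ->
    (nd h (t, (gam u).2) (t, (gam v).2) <= (k * (T v - T u))%:E)%E.
  move=> au uv vb kw; have Tuv : T u < T v by exact: (rising_lt rg).
  have [|c [uc cv Tc]] := rising_IVT (y := (T u + T v) / 2) rg au (ltW uv) vb.
    by apply/andP; rewrite -/(T u) -/(T v); lra.
  have TcE : T c = (T u + T v) / 2 by [].
  (* Each leg has height at most half the width of the window, so it fits above [t] or else below
     it. *)
  have [e [e1 we]] : exists e : R, (e = 1 \/ e = -1) /\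
      w1 <= t + e * k * (T c - T u) <= w2.
    rewrite TcE; have [tl|tl] := leP (t + 1 * k * ((T u + T v) / 2 - T u)) w2.
      exists 1; split; first by left.
      have : 0 <= k * (T v - T u) by rewrite mulr_ge0// ?subr_ge0 ltW.
      by lra.
    by exists (-1); split; [right|lra].
  have e1' : - e = 1 \/ - e = -1 by case: e1 => ->; rewrite ?opprK; auto.
  have tE : t = (t + e * k * (T c - T u)) + (- e) * k * (T v - T c).
    by rewrite TcE; field.
  apply: le_trans (null_dist_triangle _ _ _ (t + e * k * (T c - T u), (gam c).2) _ _) _.
  have -> : k * (T v - T u) = k * (T c - T u) + k * (T v - T c) by ring.
  rewrite EFinD; apply: leeD; first by apply: step => //; exact: ltW (lt_le_trans cv vb).
  have := @step c v (- e) (t + e * k * (T c - T u)).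
  by rewrite -tE; apply=> //; exact: le_trans au (ltW uc).
(* Induction on the number of teeth: as long as the total height exceeds the width of the window, a
   tooth using exactly [w2 - w1] is split off. *)
suff H (N : nat) u v : a <= u -> u < v -> v <= b ->
    k * (T v - T u) <= N%:R * (w2 - w1) ->
    (nd h (t, (gam u).2) (t, (gam v).2) <= (k * (T v - T u))%:E)%E.
  apply: (H (Num.bound (k * (T b - T a) / (w2 - w1)))) => //.
  rewrite -ler_pdivrMr ?subr_gt0//; apply/ltW/archi_boundP.
  by rewrite divr_ge0 ?mulr_ge0 ?subr_ge0// ltW//; exact: (rising_lt rg).
elim: N u v => [|N IH] u v au uv vb kN.
  by apply: base => //; apply: (le_trans kN); rewrite mul0r subr_ge0 ltW.
have [kw|kw] := leP (k * (T v - T u)) (w2 - w1); first exact: base.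
have d0 : 0 < (w2 - w1) / k by rewrite divr_gt0 ?subr_gt0.
have [|c [uc cv Tc]] := rising_IVT (y := T u + (w2 - w1) / k) rg au (ltW uv) vb.
  rewrite -/(T u) -/(T v) ltrDl d0 -ltrBrDl ltr_pdivrMr//; lra.
have TcE : k * (T c - T u) = w2 - w1.
  by rewrite /T Tc /T addrC addKr mulrC divfK ?gt_eqF.
apply: le_trans (null_dist_triangle _ _ _ (t, (gam c).2) _ _) _.
have -> : k * (T v - T u) = k * (T c - T u) + k * (T v - T c) by ring.
rewrite EFinD; apply: leeD.
  by apply: base => //; [lra|rewrite TcE].
apply: IH => //; first lra.
by have := kN; rewrite -natr1; lra.
Qed.

(* The spatial path is first followed at [k] times its speed, until the final
   time is reached; the rest of it is covered by [warped_horizontal]. *)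
Lemma warped_local h J gam a b (k e w1 w2 : R) :
  rising J gam a b -> a < b -> 1 < k -> e = 1 \/ e = -1 ->
  t0 <= w1 -> w1 < w2 -> w2 <= t1 ->
  (forall s, a <= s <= b -> w1 <= e * (gam s).1 <= w2) ->
  (forall s i r, a <= s <= b -> w1 <= r <= w2 ->
     chart_dom (chart_at i) (gam s).2 ->
     h r ^+ 2 * speed2 i gam s <= (k * tder gam s) ^+ 2) ->
  (nd h ((e * (gam a).1)%R, (gam a).2) ((e * (gam b).1)%R, (gam b).2) <=
     (k * ((gam b).1 - (gam a).1))%:E)%E.
Proof.
move=> rg ab k1 e1 tw1 w12 wt2 wT hk; pose T s := (gam s).1.
have k0 : 0 < k by lra.
have Tab : T a < T b by exact: (rising_lt rg).
have d0 : 0 < (T b - T a) / k by rewrite divr_gt0 ?subr_gt0.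
(* The accelerated leg reaches the final time at the parameter [c], after a cost
   [T b - T a = k * (T c - T a)]; the remaining horizontal part costs [k * (T b - T c)], and the sum
   is exactly the claimed bound. *)
have [|c [ac cb Tc]] :=
    rising_IVT (y := T a + (T b - T a) / k) rg (lexx a) (ltW ab) (lexx b).
  rewrite -/(T a) -/(T b) ltrDl d0 -ltrBrDl ltr_pdivrMr// ltr_pMr// subr_gt0.
  by rewrite Tab.
have TcE : k * (T c - T a) = T b - T a.
  by rewrite /T Tc /T addrC addKr mulrC divfK ?gt_eqF.
apply: le_trans (null_dist_triangle _ _ _ (e * (gam b).1, (gam c).2) _ _) _.
have -> : k * ((gam b).1 - (gam a).1) = (T b - T a) + k * (T b - T c).
  by rewrite -[X in _ = X + _]TcE /T; ring.
rewrite EFinD; apply: leeD; last first.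
  apply: (warped_horizontal (J := J) (w1 := w1) (w2 := w2)) => //.
  - by apply: rising_sub rg => //; exact: ltW.
  - by apply: wT; rewrite lexx ltW.
  - by move=> s i r sab; apply: hk; lra.
have TM s : a <= s <= c -> w1 <= e * T a + e * k * (T s - T a) <= w2.
  move=> /andP[as_ sc].
  have := rising_le rg (lexx a) as_ (le_trans sc (ltW cb)).
  have := rising_le rg as_ sc (ltW cb); rewrite -/(T a) -/(T s) -/(T c).
  move=> /(ler_wpM2l (ltW k0)) q1 /(ler_wpM2l (ltW k0)) q2.
  have := wT a; have := wT b; rewrite -/(T a) -/(T b) !lexx (ltW ab).
  by move=> /(_ isT) + /(_ isT); case: e1 => ->; lra.
have eb : e * T a + e * k * (T c - T a) = e * T b.
  by rewrite -mulrA TcE mulrBr addrC subrK.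
have /null_dist_step : causal_step (warped_metric sigma h) M
     (e * T a, (gam a).2) (e * T a + e * k * (T c - T a), (gam c).2).
  apply: (warped_step (J := J)) => //.
  - by apply: rising_sub rg => //; exact: ltW.
  - by move=> s /TM; rewrite -/(T a) -/(T s); lra.
  - by move=> s i sac dom; apply: hk => //; [lra|exact: TM].
move=> /(_ fst)/le_trans; rewrite eb; apply.
rewrite lee_fin /= -mulrBr normrM (gtr0_norm (_ : 0 < T b - T a)) ?subr_gt0//.
by case: e1 => ->; rewrite ?normrN normr1 mul1r.
Qed.

End Warped.

(** * Comparison of warping functions *)

(** Cousin's lemma, by a supremum argument: the local property at the supremum of the points reached
    from [a] would carry the interval beyond it, unless it is [b]. *)
Lemma cousin (R : realType) (P : R -> R -> Prop) (a b : R) : a < b ->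
  (forall u v w, a <= u -> u < v -> v < w -> w <= b ->
     P u v -> P v w -> P u w) ->
  (forall s, a <= s <= b -> exists2 d, 0 < d &
     forall u v, a <= u -> u <= s -> s <= v -> v <= b -> u < v -> v - u < d ->
       P u v) ->
  P a b.
Proof.
move=> ab Padd Ploc; pose E := [set s | a < s <= b /\ P a s].
have E0 : E !=set0.
  have [|d d0 Pd] := Ploc a; first by rewrite lexx ltW.
  have am : a < Num.min b (a + d / 2) by rewrite lt_min ab /=; lra.
  exists (Num.min b (a + d / 2)); rewrite /E /= am ge_min lexx; split=> //.
  apply: Pd => //; [exact: ltW|by rewrite ge_min lexx|].
  have : Num.min b (a + d / 2) <= a + d / 2 by rewrite ge_min lexx orbT.
  by lra.
have ubE : ubound E b by move=> s [/andP[]].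
have hE : has_sup E by split=> //; exists b.
have cb : sup E <= b by exact: ge_sup.
have Ec s : E s -> s <= sup E by move=> Es; exact: sup_upper_bound.
have ac : a <= sup E by case: E0 => s Es; have := Ec _ Es; case: Es; lra.
have [|d d0 Pd] := Ploc (sup E); first by rewrite ac cb.
have [|s Es cs] := @sup_adherent _ E (d / 3) _ hE; first by rewrite divr_gt0.
have sc := Ec _ Es; have [/andP[as_ sb] Pas] := Es.
(* A reached point [s] lies less than [d / 3] below the supremum and [v] at most [d / 3] above it,
   so [v - s < d]. *)
set v := Num.min b (sup E + d / 3).
have vb : v <= b by rewrite ge_min lexx.
have vd : v <= sup E + d / 3 by rewrite ge_min lexx orbT.
have cv : sup E <= v by rewrite le_min cb /=; lra.
have vE : sup E < v \/ v = b.
  rewrite /v minEle; case: ifP => _; first by right.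
  by left; lra.
have [sv|vs] := ltP s v; last first.
  by case: vE => [|vb']; [lra|have <- : s = b by lra].
have Pav : P a v.
  by apply: (Padd _ s) => //; apply: Pd => //; lra.
case: vE => [cv'|<- //].
have : v <= sup E by apply: Ec; split=> //; rewrite vb (lt_trans as_ sv).
by rewrite leNgt cv'.
Qed.

Lemma within_continuous_dist (R : realType) (g : R -> R) (a b t e : R) :
  {within `[a, b], continuous g} -> a <= t <= b -> 0 < e ->
  exists2 d, 0 < d & forall r, a <= r <= b -> `|r - t| < d -> `|g r - g t| < e.
Proof.
move=> /subspace_continuousP gc tab e0.
have tI : [set` `[a, b]] t by rewrite /= in_itv.
have /cvgrPdist_lt/(_ e e0) := gc t tI.
move=> /nbhs_ballP[d /= d0 H]; exists d => // r rab rt.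
by rewrite distrC; apply: H; rewrite /= ?in_itv// /ball /= distrC.
Qed.

Lemma within_continuous_ratio (R : realType) (g : R -> R) (a b t q : R) :
  {within `[a, b], continuous g} -> a <= t <= b -> 0 < g t -> 1 < q ->
  exists2 d, 0 < d & forall r, a <= r <= b -> `|r - t| < d ->
    g r <= q * g t /\ g t <= q * g r.
Proof.
move=> gc tab g0 q1.
(* This tolerance gives [g r > g t / q] directly, and [g r < g t * (2 - 1 / q) <= q * g t] because
   [q + 1 / q >= 2]. *)
have e0 : 0 < g t * (1 - q^-1).
  by rewrite mulr_gt0// subr_gt0 invf_lt1//; lra.
have [d d0 H] := within_continuous_dist gc tab e0.
exists d => // r rab /(H _ rab); rewrite ltr_norml => /andP[r1 r2].
have qV : q * q^-1 = 1 by rewrite divff//; lra.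
have q0 : 0 < q^-1 by rewrite invr_gt0; lra.
split; last first.
  have : q * (g t * q^-1) <= q * g r by rewrite ler_wpM2l//; lra.
  by rewrite mulrCA qV mulr1.
have : 0 <= g t * (q - 1) * (1 - q^-1) by rewrite !mulr_ge0//; nra.
have -> : g t * (q - 1) * (1 - q^-1) = g t * (q + q^-1 - 1 - q * q^-1) by ring.
by rewrite qV; lra.
Qed.

(** Let [q] tend to 1. The exponent matches the four factors [q] lost to continuity in
    [rising_dist]. *)
Lemma lee_pow4P (R : realType) (x : \bar R) (D : R) : 0 <= D ->
  (forall q, 1 < q -> (x <= (q ^+ 4 * D)%:E)%E) -> (x <= D%:E)%E.
Proof.
move=> D0 H; apply/lee_addgt0Pr => e e0.
(* For [0 < d <= 1], [(1 + d) ^+ 4 <= 1 + 15 * d], where 15 = 4 + 6 + 4 + 1; using [D + 1] keeps the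
   denominator positive. *)
pose d := Num.min 1 (e / (15 * (D + 1))).
have De : 0 < 15 * (D + 1) by lra.
have d0 : 0 < d by rewrite lt_min ltr01 divr_gt0.
have d1 : d <= 1 by rewrite ge_min lexx.
have dD : d * (15 * (D + 1)) <= e.
  by rewrite -ler_pdivlMr// ge_min lexx orbT.
apply: (le_trans (H (1 + d) _)); first lra.
rewrite -EFinD lee_fin.
have q4 : (1 + d) ^+ 4 <= 1 + 15 * d.
  have d2 : d ^+ 2 <= d by rewrite expr2; nra.
  have d3 : d ^+ 3 <= d by rewrite exprS; nra.
  have d4 : d ^+ 4 <= d by rewrite exprS; nra.
  have -> : (1 + d) ^+ 4 = 1 + 4 * d + 6 * d ^+ 2 + 4 * d ^+ 3 + d ^+ 4 by ring.
  lra.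
by have := ler_wpM2r D0 q4; nra.
Qed.

Section Comparison.
Context (R : realType) (n : nat) (S : topologicalType).
Context (A : smooth_manifold R n S) (sigma : riemannian_metric A).
Context (t0 t1 : R) (lt_t0_t1 : t0 < t1).

Local Notation M := (@spacetime R S t0 t1).
Local Notation nd h := (null_dist (warped_metric sigma h) M fst).

Lemma metric_form_ge0 i x v : chart_dom (chart_at i) x ->
  0 <= metric_form sigma i x v v.
Proof.
move=> dom; have [->|v0] := eqVneq v 0; first by rewrite metric_form0r.
exact/ltW/metric_pos.
Qed.

(* All that is needed from [Phi t], an integral of [phi] from [t0] to [t]. *)
Definition primitive_above (phi Phi : R -> R) := forall m u v,
  t0 <= u -> u <= v -> v <= t1 -> (forall r, u <= r <= v -> m <= phi r) ->
  m * (v - u) <= Phi v - Phi u.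

Context (h f phi Phi : R -> R).
Hypothesis h_pos : forall t, t0 <= t <= t1 -> 0 < h t.
Hypothesis h_cont : {within `[t0, t1], continuous h}.
Hypothesis phi_cont : {within `[t0, t1], continuous phi}.
Hypothesis phi_ge1 : forall t, t0 <= t <= t1 -> 1 <= phi t.
Hypothesis Phi_above : primitive_above phi Phi.
Hypothesis h_le : forall t, t0 <= t <= t1 -> h t <= phi t * f t.

(** Near each parameter [h] and [phi] vary by at most a factor [q], so [warped_local] bounds the
    distance across a short subinterval by [q ^+ 4] times the increment of [Phi]. These bounds are
    added up by [cousin], and then [q] tends to 1. *)
Lemma rising_dist J (gam : R -> R * S) a b e :
  rising A J gam a b -> a < b -> e = 1 \/ e = -1 ->
  (forall s, a <= s <= b -> t0 <= e * (gam s).1 <= t1) ->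
  (forall s i, a <= s <= b -> chart_dom (chart_at i) (gam s).2 ->
     f (e * (gam s).1) ^+ 2 * speed2 sigma i gam s <= tder gam s ^+ 2) ->
  (nd h ((e * (gam a).1)%R, (gam a).2) ((e * (gam b).1)%R, (gam b).2) <=
    `|Phi (e * (gam b).1) - Phi (e * (gam a).1)|%:E)%E.
Proof.
move=> rg ab e1 TM hk.
(* The outer sign makes [G] nondecreasing in both time directions. *)
pose T s := (gam s).1; pose G s := e * Phi (e * T s).
have Gincr m u v w1 w2 : a <= u -> u <= v -> v <= b ->
    w1 <= e * T u <= w2 -> w1 <= e * T v <= w2 ->
    (forall y, w1 <= y <= w2 -> m <= phi y) ->
    m * (T v - T u) <= G v - G u.
  move=> au uv vb; have := rising_le rg au uv vb; rewrite -/(T u) -/(T v).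
  have := TM u; have := TM v; rewrite au (le_trans uv vb) (le_trans au uv) vb.
  move=> /(_ isT) + /(_ isT); rewrite -/(T u) -/(T v) /G.
  case: e1 => ->; rewrite !(mul1r, mulN1r) => Tv Tu Tuv wu wv mle.
    by apply: Phi_above => //; [lra|lra|move=> y yW; apply: mle; lra].
  have -> : T v - T u = - T u - - T v by ring.
  rewrite [leRHS]addrC (opprK (Phi _)).
  by apply: Phi_above; [lra|lra|lra|move=> y yW; apply: mle; lra].
have TG : T b - T a <= G b - G a.
  rewrite -[leLHS]mul1r; apply: (Gincr _ _ _ t0 t1) => //; first exact: ltW.
  - by apply: TM; rewrite lexx ltW.
  - by apply: TM; rewrite lexx ltW.
have G0 : 0 <= G b - G a.
  by apply: le_trans TG; rewrite subr_ge0; apply: (rising_le rg) => //; exact: ltW.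
suff H : (nd h ((e * T a)%R, (gam a).2) ((e * T b)%R, (gam b).2) <=
    (G b - G a)%:E)%E.
  apply: (le_trans H); rewrite lee_fin /G -mulrBr -/(T a) -/(T b).
  have := ler_norm (Phi (e * T b) - Phi (e * T a)).
  have := ler_norm (- (Phi (e * T b) - Phi (e * T a))); rewrite normrN.
  by case: e1 => ->; lra.
apply: lee_pow4P => // q q1.
pose P u v := (nd h ((e * T u)%R, (gam u).2) ((e * T v)%R, (gam v).2) <=
    (q ^+ 4 * (G v - G u))%:E)%E.
apply: (@cousin R P a b ab) => [u v w au uv vw wb Puv Pvw|s sab].
  rewrite /P; apply: le_trans (null_dist_triangle _ _ _ (e * T v, (gam v).2) _ _) _.
  have -> : q ^+ 4 * (G w - G u) = q ^+ 4 * (G v - G u) + q ^+ 4 * (G w - G v).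
    by ring.
  by rewrite EFinD; exact: leeD.
set t := e * T s; have tM : t0 <= t <= t1 by exact: TM.
have [d1 d10 hd] := within_continuous_ratio h_cont tM (h_pos tM) q1.
have phi0 r : t0 <= r <= t1 -> 0 < phi r by move=> /phi_ge1; lra.
have [d2 d20 phid] := within_continuous_ratio phi_cont tM (phi0 _ tM) q1.
pose d := Num.min d1 d2.
have d0 : 0 < d by rewrite lt_min d10.
have dd1 : d <= d1 by rewrite ge_min lexx.
have dd2 : d <= d2 by rewrite ge_min lexx orbT.
have d20' : 0 < d / 2 by lra.
have [d3 d30 Td] := within_continuous_dist (rising_continuous rg) sab d20'.
exists d3 => // u v au us sv vb uv vu.
(* The window around [t] is clipped to [[t0, t1]]; it keeps positive width even when [t] is an
   endpoint. *)
pose w1 := Num.max t0 (t - d / 2); pose w2 := Num.min t1 (t + d / 2).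
have w1r r : (w1 <= r) = (t0 <= r) && (t - d / 2 <= r) by rewrite ge_max.
have w2r r : (r <= w2) = (r <= t1) && (r <= t + d / 2) by rewrite le_min.
have tw1 : t0 <= w1 by rewrite le_max lexx.
have wt2 : w2 <= t1 by rewrite ge_min lexx.
have w12 : w1 < w2.
  have [tM1 tM2] := andP tM; rewrite gt_max !lt_min lt_t0_t1 /=.
  by apply/and3P; split; lra.
have TW r : u <= r <= v -> w1 <= e * T r <= w2.
  move=> ruv; have rab : a <= r <= b by lra.
  have := Td r rab; rewrite -/(T r) -/(T s) => Tr.
  have {}Tr : `|e * T r - t| < d / 2.
    rewrite /t -mulrBr normrM.
    have -> : `|e| = 1 by case: e1 => ->; rewrite ?normrN normr1.
    by rewrite mul1r; apply: Tr; rewrite ltr_norml; lra.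
  move: Tr; rewrite ltr_norml w1r w2r => Tr; have := TM r rab; rewrite -/(T r).
  lra.
have Wd r : w1 <= r <= w2 -> t0 <= r <= t1 /\ `|r - t| < d.
  by rewrite w1r w2r ltr_norml; lra.
have q0 : 0 < q by lra.
have pt := phi0 _ tM.
(* For times [r], [z] in the window, [h r <= q * h t <= q ^+ 2 * h z <= q ^+ 2 * phi z * f z <= q ^+
   3 * phi t * f z]. *)
pose k := q ^+ 3 * phi t.
have q31 : 1 < q ^+ 3 by rewrite exprn_egt1.
have k1 : 1 < k by rewrite /k; have := phi_ge1 tM; nra.
have rg' := rising_sub au vb rg.
have hloc r z : w1 <= r <= w2 -> w1 <= z <= w2 -> h r <= k * f z /\ 0 < f z.
  move=> /Wd[rM rd] /Wd[zM zd].
  have [h1 _] := hd r rM (lt_le_trans rd dd1).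
  have [_ h2] := hd z zM (lt_le_trans zd dd1).
  have [p1 _] := phid z zM (lt_le_trans zd dd2).
  have f0 : 0 < f z.
    have := lt_le_trans (h_pos zM) (h_le zM).
    by rewrite pmulr_rgt0 ?phi0.
  split=> //; apply: (le_trans h1).
  have -> : k * f z = q * (q * (q * phi t * f z)) by rewrite /k; ring.
  rewrite ler_pM2l//; apply: (le_trans h2); rewrite ler_pM2l//.
  by apply: (le_trans (h_le zM)); rewrite ler_pM2r.
have := @warped_local R n S A sigma t0 t1 h J gam u v k e w1 w2 rg' uv k1 e1 tw1 w12 wt2 TW.
move=> H; apply: (le_trans (H _)) => [r i y ruv yW dom|].
  have rab : a <= r <= b by lra.
  have [hk1 f0] := hloc y _ yW (TW r ruv).
  have hy0 : 0 < h y by apply: h_pos; case: (Wd _ yW).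
  have sp0 : 0 <= speed2 sigma i gam r by exact: metric_form_ge0.
  rewrite exprMn; apply: (@le_trans _ _ ((k * f (e * T r)) ^+ 2 * speed2 sigma i gam r)).
    rewrite ler_wpM2r// ler_sqr ?nnegrE//; first exact: ltW.
    by apply: mulr_ge0; lra.
  rewrite exprMn -mulrA ler_wpM2l ?sqr_ge0//; exact: hk.
rewrite lee_fin /k -/(T u) -/(T v).
(* The fourth factor [q]: [phi] is at least [phi t / q] on the window. *)
have := Gincr (q^-1 * phi t) u v w1 w2 au (ltW uv) vb.
rewrite !TW ?lexx ?(ltW uv)// => /(_ isT isT) Gle.
have {}Gle : q^-1 * phi t * (T v - T u) <= G v - G u.
  apply: Gle => y /Wd[yM yd]; rewrite ler_pdivrMl//.
  by case: (phid y yM (lt_le_trans yd dd2)).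
have q40 : 0 <= q ^+ 4 by rewrite exprn_ge0// ltW.
apply: le_trans (ler_wpM2l q40 Gle); rewrite le_eqVlt; apply/orP; left.
by apply/eqP; field; rewrite gt_eqF.
Qed.

(** The product of the velocity with d/dt is [- tder gam s], so a future directed piece is rising. A
    past directed one becomes rising when its time is negated, which is the case [e = -1] of
    [rising_dist]. *)
Lemma causal_step_dist p q : causal_step (warped_metric sigma f) M p q ->
  (nd h p q <= `|Phi q.1 - Phi p.1|%:E)%E.
Proof.
move=> [beta [a [b [ab Mb pc <- <-]]]].
have [J [gam [oJ abJ [s1 s2 s3] gb Cg]]] : exists (J : set R) gam,
    [/\ open J, `[a, b] `<=` J, smooth_curve A J gam,
        forall s, a <= s <= b -> gam s = beta s &
        (forall s i, a <= s <= b -> chart_dom (chart_at i) (gam s).2 ->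
          future_causal (warped_metric sigma f) i (gam s) (velocity i gam s)) \/
        (forall s i, a <= s <= b -> chart_dom (chart_at i) (gam s).2 ->
          past_causal (warped_metric sigma f) i (gam s) (velocity i gam s))].
  case: pc => [] [J [gam [oJ abJ sJ gb Cg]]]; exists J, gam; split=> //.
    by left.
  by right.
have causalE i s : a <= s <= b ->
    causal_vector (warped_metric sigma f) i (gam s) (velocity i gam s) ->
    f (gam s).1 ^+ 2 * speed2 sigma i gam s <= tder gam s ^+ 2.
  by move=> sab [_]; rewrite /warped_metric /= addrC subr_le0 -expr2.
have [ga gb'] : gam a = beta a /\ gam b = beta b.
  by split; apply: gb; rewrite lexx ltW.
have dtE i s : warped_metric sigma f i (gam s) (velocity i gam s) (dt_field R n)
    = - tder gam s.
  by rewrite /warped_metric /= metric_form0r mulr0 addr0 mulr1.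
have gM s : a <= s <= b -> t0 <= (gam s).1 <= t1.
  by move=> sab; rewrite (gb _ sab); exact: Mb.
rewrite -ga -gb'; case: Cg => Cg.
  have rg : rising A J gam a b.
    split=> // s sab; have [i dom] := chart_cover A (gam s).2.
    by have [_] := Cg s i sab dom; rewrite dtE oppr_lt0.
  have := rising_dist rg ab (or_introl erefl); rewrite !mul1r -!surjective_pairing.
  apply=> [s /gM|s i sab dom]; first by rewrite mul1r.
  by rewrite mul1r; apply: causalE => //; case: (Cg s i sab dom).
pose gam' s := (- (gam s).1, (gam s).2).
have tder' s : a <= s <= b -> tder gam' s = - tder gam s.
  move=> sab; rewrite /tder /gam' /=.
  have [df _] := s1 1%N; apply: deriveN; apply: diff_derivable; apply: df.
  by apply: abJ; rewrite /= in_itv.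
have rg : rising A J gam' a b.
  split=> // [|s sab].
    split=> // k; rewrite (_ : (fun s => (gam' s).1) = (fun s => 0 + -1 * (gam s).1)).
      by apply: Ck_affine.
    by apply/funext => s; rewrite add0r mulN1r.
  have [i dom] := chart_cover A (gam s).2.
  by have [_] := Cg s i sab dom; rewrite dtE tder'.
have NE s : -1 * (gam' s).1 = (gam s).1 by rewrite mulN1r opprK.
have := rising_dist rg ab (or_intror erefl).
rewrite !NE /= -!surjective_pairing; apply=> [s /gM|s i sab dom].
  by rewrite NE.
rewrite NE tder'// sqrrN.
by apply: causalE => //; case: (Cg s i sab dom).
Qed.

End Comparison.

(** [N] is the number of pieces of the chain. It is chosen before [g'], [c] and [I], so one [N]
    serves a whole sequence of metrics. *)
Lemma causal_chain_dist (R : realType) (n : nat) (S : topologicalType)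
    (A : smooth_manifold R n S) (g : spacetime_metric A) (M : set (R * S))
    (tau : R * S -> R) p q l :
  causal_chain g M tau p q l -> exists N : nat,
    forall (g' : spacetime_metric A) (c I : R),
    (forall p q, causal_step g M p q ->
       (null_dist g' M tau p q <= (c * `|tau q - tau p| + I)%:E)%E) ->
    (null_dist g' M tau p q <= (c * l + N%:R * I)%:E)%E.
Proof.
elim=> {q l} [q st|q r l _ [N IH] st].
  by exists 1%N => g' c I /(_ _ _ st); rewrite mul1r.
exists N.+1 => g' c I H; apply: le_trans (null_dist_triangle _ _ _ q _ _) _.
apply: le_trans (leeD (IH _ _ _ H) (H _ _ st)) _.
by rewrite -EFinD lee_fin -natr1; lra.
Qed.

(** * Coordinate segments *)

Lemma sub_segment (K : pzRingType) (V : lmodType K) (a b c : V) (s : K) :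
  a - (b + s *: (c - b)) = (1 - s) *: (a - b) + s *: (a - c).
Proof.
have -> : a - c = (a - b) - (c - b) by rewrite opprB addrA subrK.
by rewrite [X in _ = _ + X]scalerBr scalerBl scale1r addrA subrK opprD addrA.
Qed.

Lemma mx_entry_le_norm (R : realType) m n (B : 'M[R]_(m, n)) i j :
  `|B i j| <= `|B|.
Proof.
rewrite [leRHS]mx_normrE.
exact: (le_bigmax _ (fun ij : 'I_m * 'I_n => `|B ij.1 ij.2|) (i, j)).
Qed.

(** The norms are maxima of absolute values of entries, and the form is a sum of [n ^ 2] terms, each
    at most [|v| ^ 2 * |B|]. *)
Lemma quad_form_le (R : realType) n (B : 'M[R]_n) (v : 'rV[R]_n) :
  (v *m B *m v^T) 0 0 <= (n%:R * `|v|) ^+ 2 * `|B|.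
Proof.
apply: le_trans (ler_norm _) _; rewrite mxE.
apply: (le_trans (ler_norm_sum _ _ _)).
apply: (@le_trans _ _ (\sum_(j < n) (n%:R * `|v| ^+ 2 * `|B|))); last first.
  by rewrite sumr_const card_ord -mulr_natl exprMn; lra.
apply: ler_sum => j _; rewrite normrM [(_ *m _) _ _]mxE [v^T _ _]mxE.
have vB : `|\sum_k v 0 k * B k j| <= n%:R * (`|v| * `|B|).
  apply: (le_trans (ler_norm_sum _ _ _)).
  apply: (@le_trans _ _ (\sum_(k < n) (`|v| * `|B|))); last first.
    by rewrite sumr_const card_ord mulr_natl.
  by apply: ler_sum => k _; rewrite normrM ler_pM ?mx_entry_le_norm.
apply: (le_trans (ler_pM _ _ vB (mx_entry_le_norm v 0 j))) => //.
by rewrite expr2; lra.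
Qed.

Section ChartLines.
Context (R : realType) (n : nat) (S : topologicalType).
Context (A : smooth_manifold R n S) (sigma : riemannian_metric A).

Local Notation img i := (chart_map (chart_at i) @` chart_dom (chart_at i)).

(** The time component is the parameter itself, so the curve is rising with [tder] equal to 1; later
    constructions reuse only its spatial path. *)
Definition chart_line (i : chart_index A) (y v : 'rV[R]_n) (s : R) : R * S :=
  (s, chart_inv (chart_at i) (y + s *: v)).

Lemma chart_invP (c : chart R n S) y : (chart_map c @` chart_dom c) y ->
  chart_dom c (chart_inv c y) /\ chart_map c (chart_inv c y) = y.
Proof. by move=> [x dx <-]; rewrite chart_mapK. Qed.

Lemma tder_chart_line i y v s : tder (chart_line i y v) s = 1.
Proof. by rewrite /tder /= derive_id. Qed.

Lemma rising_chart_line i y v a b :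
  (forall s, a <= s <= b -> img i (y + s *: v)) ->
  rising A ((fun s => y + s *: v) @^-1` img i) (chart_line i y v) a b.
Proof.
move=> abI; split.
- apply: open_comp => [s _|]; first exact: continuous_line.
  exact: chart_codom_open.
- by move=> s /=; rewrite in_itv /= => /abI.
- split=> [k|s Is|j k].
  + exact: Ck_id.
  + have cl : {for s, continuous (fun s : R => y + s *: v)}.
      exact: continuous_line.
    exact: (continuous_comp cl (chart_inv_cont Is)).
  (* In chart [j] the path is a transition map along an affine line, hence smooth by compatibility
     of the charts; what remains is to match the two domains. *)
  + have := Ck_line y v (@chart_compat R n S A i j k).
    congr (Ck _ _ _); apply/seteqP; split=> s /=.
      move=> [x [dix djx] xE]; rewrite -xE chart_mapK//.
      by split=> //; exists x.
    move=> [/chart_invP[d1 d2] dj].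
    by exists (chart_inv (chart_at i) (y + s *: v)).
- by move=> s _; rewrite tder_chart_line.
Qed.

(** In chart [j] the velocity is the derivative of the transition map along [v], which is the vector
    to which [metric_change] transports [v]. *)
Lemma speed2_chart_line i j y v s : img i (y + s *: v) ->
  chart_dom (chart_at j) (chart_line i y v s).2 ->
  speed2 sigma j (chart_line i y v) s =
    metric_form sigma i (chart_line i y v s).2 v v.
Proof.
move=> /chart_invP[di dE] dj; rewrite (metric_change sigma di dj) dE.
rewrite /speed2; lazy zeta; suff -> : (velocity j (chart_line i y v) s).2 =
  'D_v (transition (chart_at i) (chart_at j)) (y + s *: v) by [].
have /(congr1 (fun h => h s)) /= :=
  derive_line (transition (chart_at i) (chart_at j)) y v 1.
by rewrite scale1r.
Qed.

Context (t0 t1 : R) (lt_t0_t1 : t0 < t1).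
Local Notation M := (@spacetime R S t0 t1).
Local Notation nd h := (null_dist (warped_metric sigma h) M fst).

Lemma chart_line_dist h i y v (k w1 w2 t : R) :
  (forall s, 0 <= s <= 1 -> img i (y + s *: v)) -> 0 < k ->
  t0 <= w1 -> w1 < w2 -> w2 <= t1 -> w1 <= t <= w2 ->
  (forall s r, 0 <= s <= 1 -> w1 <= r <= w2 ->
     h r ^+ 2 * metric_form sigma i (chart_line i y v s).2 v v <= k ^+ 2) ->
  (nd h (t, chart_inv (chart_at i) y) (t, chart_inv (chart_at i) (y + v)) <=
     k%:E)%E.
Proof.
move=> yv k0 tw1 w12 wt2 wt hk.
have := @warped_horizontal _ _ _ _ sigma t0 t1 h _ _ _ _ k w1 w2 t
  (rising_chart_line yv) ltr01 k0 tw1 w12 wt2 wt.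
rewrite /chart_line /= scale0r addr0 scale1r subr0 mulr1; apply.
move=> s j r s01 rw dom; rewrite tder_chart_line mulr1.
by rewrite speed2_chart_line//; [exact: hk|exact: yv].
Qed.

Lemma null_dist_vertical h x (t t' : R) : t0 <= t <= t1 -> t0 <= t' <= t1 ->
  (nd h (t, x) (t', x) <= `|t' - t|%:E)%E.
Proof.
move=> tM tM'; have [i dom] := chart_cover A x.
pose y := chart_map (chart_at i) x.
have yv s : 0 <= s <= 1 -> img i (y + s *: 0) by rewrite scaler0 addr0; exists x.
have form0 s : metric_form sigma i (chart_line i y 0 s).2 0 0 = 0.
  exact: metric_form0r.
have yx : chart_inv (chart_at i) y = x by exact: chart_mapK.
(* A causal curve has positive null length, so for equal times the distance 0 is only approached, by
   zigzags over the constant path at [x] of arbitrarily small length [k]. *)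
have [->|tt'] := eqVneq t' t.
  rewrite subrr normr0; apply/lee_addgt0Pr => k k0; rewrite add0e.
  have := @chart_line_dist h i y 0 k t0 t1 t yv k0 (lexx _) lt_t0_t1 (lexx _) tM.
  rewrite addr0 yx; apply=> s r _ _.
  by rewrite form0 mulr0 sqr_ge0.
pose e : R := if t < t' then 1 else -1.
have eE : e * `|t' - t| = t' - t.
  rewrite /e; case: ltP => H; first by rewrite mul1r ger0_norm// subr_ge0 ltW.
  by rewrite mulN1r ler0_norm ?opprK// subr_le0.
have e1 : e = 1 \/ e = -1 by rewrite /e; case: ifP; auto.
have k0 : 0 < `|t' - t| by rewrite normr_gt0 subr_eq0.
have := @warped_step _ _ _ _ sigma t0 t1 h _ _ _ _ e `|t' - t| t
  (rising_chart_line yv) ltr01 k0 e1.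
rewrite /chart_line /= !scaler0 addr0 yx eE subr0 mulr1 (addrC t) subrK.
move=> H; apply: le_trans (null_dist_step fst (H _ _)) _ => [s s01|s j s01 domj|//].
  have : s * (t' - t) = (1 - s) * 0 + s * (t' - t) by ring.
  by rewrite subr0; nra.
rewrite -/(chart_line i y 0) speed2_chart_line//; last exact: yv.
by rewrite form0 mulr0 sqr_ge0.
Qed.

(** The bound is uniform over all functions [h], and requires [h <= H] only on some time window
    around [t]; this allows [h] to be large elsewhere. *)
Definition horizontally_close (m : R) (x x' : S) := forall h H w1 w2 t,
  0 < H -> t0 <= w1 -> w1 < w2 -> w2 <= t1 -> w1 <= t <= w2 ->
  (forall r, w1 <= r <= w2 -> 0 <= h r <= H) ->
  (nd h (t, x) (t, x') <= (m * H)%:E)%E.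

(** In a chart at [x0] the Gram matrix is bounded near [x0], so coordinate segments inside a small
    ball have [sigma]-length at most [m]. *)
Lemma nbhs_horizontally_close (m : R) x0 : 0 < m ->
  exists2 U : set S, open_nbhs x0 U &
    forall x x', U x -> U x' -> horizontally_close m x x'.
Proof.
move=> m0; have [i dom] := chart_cover A x0.
pose c := chart_at i; pose y0 := chart_map c x0.
have Iy0 : img i y0 by exists x0.
pose F := metric_mx sigma i \o chart_inv c.
have /cvgrPdist_lt/(_ 1 ltr01)/nbhs_ballP[d1 /= d10 Hd1] : F @ y0 --> F y0.
  exact: (metric_smooth sigma i 0%N y0 Iy0).
have Fy0 : F y0 = metric_mx sigma i x0 by rewrite /F /= chart_mapK.
have /nbhs_ballP[d2 /= d20 Hd2] : nbhs y0 (img i).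
  by apply: open_nbhs_nbhs; split=> //; exact: chart_codom_open.
pose B := `|metric_mx sigma i x0| + 1.
have B0 : 0 < B by rewrite ltr_wpDl.
(* A segment in the ball has [|v| <= 2 * d], so the last term ensures [n%:R * |v| * (B + 1) <= m];
   with [B <= (B + 1) ^+ 2] this gives a form of at most [m ^+ 2]. The successor of [n] keeps the
   denominator positive in dimension 0. *)
pose d := Num.min (Num.min d1 d2) (m / (2 * (n.+1%:R * (B + 1)))).
have n1 : 0 < n.+1%:R :> R by [].
have nB : 0 < 2 * (n.+1%:R * (B + 1)) by rewrite !mulr_gt0//; lra.
have d0 : 0 < d by rewrite !lt_min d10 d20 divr_gt0.
have dd1 : d <= d1 by rewrite !ge_min lexx.
have dd2 : d <= d2 by rewrite !ge_min lexx orbT.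
have dm : d * (2 * (n.+1%:R * (B + 1))) <= m.
  by rewrite -ler_pdivlMr// ge_min lexx orbT.
pose U := chart_dom c `&` [set x | ball y0 d (chart_map c x)].
have U0 : nbhs x0 U.
  apply: filterI; first by apply: open_nbhs_nbhs; split=> //; exact: chart_dom_open.
  by apply: (chart_map_cont dom); exact: nbhsx_ballx.
exists (interior U).
  by split; [exact: open_interior|].
move=> x x' /interior_subset[dx bx] /interior_subset[dx' bx'].
pose y := chart_map c x; pose v : 'rV[R]_n := chart_map c x' - y.
have bl s : 0 <= s <= 1 -> ball y0 d (y + s *: v).
  move=> /andP[s0 s1]; move: bx bx'; rewrite -!ball_normE /= => bx bx'.
  have -> : y0 - (y + s *: v) = (1 - s) *: (y0 - y) + s *: (y0 - chart_map c x').
    exact: sub_segment.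
  apply: le_lt_trans (ler_normD _ _) _; rewrite !normrZ.
  rewrite ger0_norm ?subr_ge0// ger0_norm//; move: bx bx'; rewrite -/y.
  move: `|y0 - y| `|y0 - chart_map c x'| => p q pd qd; move: s1.
  rewrite le_eqVlt => /orP[/eqP ->|s1]; first lra.
  have : 0 < (1 - s) * (d - p) by apply: mulr_gt0; rewrite subr_gt0.
  have : 0 <= s * (d - q) by apply: mulr_ge0 => //; rewrite subr_ge0; exact: ltW.
  by lra.
have blI s : 0 <= s <= 1 -> img i (y + s *: v).
  by move=> /bl yb; apply: Hd2; exact: le_ball yb.
move=> h H w1 w2 t H0 tw1 w12 wt2 wt hH.
have -> : x = chart_inv c y by rewrite chart_mapK.
have -> : x' = chart_inv c (y + v) by rewrite /v addrC subrK chart_mapK.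
apply: (chart_line_dist (w1 := w1) (w2 := w2)) => //; first exact: mulr_gt0.
move=> s r s01 /hH/andP[h0 hr].
have vd : `|v| <= 2 * d.
  have -> : v = (y0 - y) - (y0 - chart_map c x').
    by rewrite opprB addrC subrKA.
  apply: le_trans (ler_normB _ _) _.
  by move: bx bx'; rewrite -!ball_normE /= -/y; lra.
have FB : `|F (y + s *: v)| <= B.
  have : ball y0 d1 (y + s *: v) by apply: le_ball (bl s s01).
  move=> /Hd1; rewrite Fy0 => /ltW Fd.
  have -> : F (y + s *: v) = metric_mx sigma i x0 - (metric_mx sigma i x0 - F (y + s *: v)).
    by rewrite subKr.
  by apply: le_trans (ler_normB _ _) _; rewrite lerD2l.
have nv0 : 0 <= n%:R * `|v| by rewrite mulr_ge0.
have nvm : n%:R * `|v| * (B + 1) <= m.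
  apply: le_trans dm; rewrite (_ : d * _ = n.+1%:R * (2 * d) * (B + 1)); last by ring.
  by rewrite ler_wpM2r ?ler_pM ?ler_nat//; lra.
have form_le : metric_form sigma i (chart_line i y v s).2 v v <= m ^+ 2.
  apply: (le_trans (quad_form_le _ _)).
  apply: (@le_trans _ _ ((n%:R * `|v| * (B + 1)) ^+ 2)).
    rewrite [leRHS]exprMn ler_wpM2l ?sqr_ge0//; apply: (le_trans FB).
    by rewrite expr2; nra.
  have nB0 : 0 <= n%:R * `|v| * (B + 1) by apply: mulr_ge0 => //; lra.
  by rewrite ler_sqr ?nnegrE// ltW.
rewrite exprMn [leLHS]mulrC; apply: (@le_trans _ _ (m ^+ 2 * h r ^+ 2)).
  by apply: ler_wpM2r => //; exact: sqr_ge0.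
by rewrite ler_wpM2l ?sqr_ge0// ler_sqr ?nnegrE// ltW.
Qed.

End ChartLines.

(** * Integrals of continuous functions as primitives *)

Section Primitive.
Context (R : realType) (t0 t1 : R).
Local Notation mu := (@lebesgue_measure R).

Lemma primitive_above_Rintegral (g : R -> R) :
  {within `[t0, t1], continuous g} ->
  primitive_above t0 t1 g (fun t => \int[mu]_(x in `[t0, t]) g x)%R.
Proof.
move=> gc m u v tu; rewrite le_eqVlt => /orP[/eqP -> _ _|uv vt mg].
  by rewrite !subrr mulr0.
have ig (a b : R) : t0 <= a -> b <= t1 -> mu.-integrable `[a, b] (EFin \o g).
  move=> ta bt; apply: continuous_compact_integrable; first exact: segment_compact.
  apply: continuous_subspaceW gc => x /=; rewrite !in_itv /=; lra.
rewrite Rintegral_itvB; last 3 first.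
- exact: ig.
- by rewrite bnd_simp.
- by rewrite bnd_simp ltW.
have iguv : mu.-integrable `]u, v] (EFin \o g).
  apply: integrableS (ig u v tu vt) => //.
  by apply: subset_itvr; rewrite bnd_simp.
have <- : (\int[mu]_(x in `]u, v]) (cst m x) = m * (v - u))%R.
  rewrite Rintegral_cst// [X in fine X]lebesgue_measure_itv /= lte_fin uv.
  by rewrite -EFinB.
apply: le_Rintegral => //.
- have icst : mu.-integrable `[u, v] (EFin \o cst m).
    apply: continuous_compact_integrable; first exact: segment_compact.
    by move=> x; exact: cst_continuous.
  by apply: integrableS icst => //; apply: subset_itvr; rewrite bnd_simp.
- by move=> x /=; rewrite in_itv /= => xuv; apply: mg; lra.
Qed.
End Primitive.

(** * Compactness *)

Lemma filter_forall_seq (T : Type) (I : eqType) (F : set_system T)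
    (FF : Filter F) (s : seq I) (P : I -> T -> Prop) :
  (forall i, i \in s -> \forall x \near F, P i x) ->
  \forall x \near F, forall i, i \in s -> P i x.
Proof.
elim: s => [|i s IH] H; first by near=> x => ?; rewrite in_nil.
have H1 := H i (mem_head _ _).
have H2 := IH (fun k ks => H k (mem_behead (s := i :: s) ks)).
near=> x => k; rewrite inE => /orP[/eqP ->|ks]; first by near: x.
by move: k ks; near: x.
Unshelve. all: by end_near. Qed.

Section Compactness.
Context (R : realType) (n : nat) (S : topologicalType).
Context (A : smooth_manifold R n S) (sigma : riemannian_metric A).
Context (t0 t1 : R) (lt_t0_t1 : t0 < t1).
Local Notation M := (@spacetime R S t0 t1).
Local Notation nd h := (null_dist (warped_metric sigma h) M fst).
Local Notation close := (horizontally_close sigma t0 t1).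

(** Move vertically to a time [s] at which [h] is below [H], horizontally there, and vertically to
    [p']. The costs are [d], [m * H] and [2 * d], as [s] is within [2 * d] of [p'.1]. *)
Lemma null_dist_close (h : R -> R) (H d m : R) (p p' : R * S) :
  (forall t, t0 <= t <= t1 -> 0 < h t) ->
  {within `[t0, t1], continuous h} -> M p -> M p' ->
  close m p.2 p'.2 -> `|p.1 - p'.1| <= d ->
  (exists s, [/\ t0 <= s <= t1, `|s - p.1| <= d & h s < H]) ->
  (nd h p p' <= (3 * d + m * H)%:E)%E.
Proof.
move=> h0 hc Mp Mp' cl dp [s [sM sp hs]].
have hs0 : 0 < H - h s by rewrite subr_gt0.
have [d1 d10 Hd1] := within_continuous_dist hc sM hs0.
have H0 : 0 < H := lt_trans (h0 _ sM) hs.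
pose w1 := Num.max t0 (s - d1 / 2); pose w2 := Num.min t1 (s + d1 / 2).
have w1r r : (w1 <= r) = (t0 <= r) && (s - d1 / 2 <= r) by rewrite ge_max.
have w2r r : (r <= w2) = (r <= t1) && (r <= s + d1 / 2) by rewrite le_min.
have w12 : w1 < w2.
  have [sM1 sM2] := andP sM; rewrite gt_max !lt_min lt_t0_t1 /=.
  by apply/and3P; split; lra.
have hW r : w1 <= r <= w2 -> 0 <= h r <= H.
  rewrite w1r w2r => rW; have rM : t0 <= r <= t1 by lra.
  have : `|r - s| < d1 by rewrite ltr_norml; lra.
  by move=> /(Hd1 r rM); rewrite ltr_norml => /andP[_ hr]; rewrite ltW ?h0//=; lra.
have D1 : (nd h p (s, p.2) <= d%:E)%E.
  rewrite [p in nd h p _]surjective_pairing.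
  apply: (le_trans (null_dist_vertical sigma lt_t0_t1 h p.2 Mp sM)).
  by rewrite lee_fin.
have D2 : (nd h (s, p.2) (s, p'.2) <= (m * H)%:E)%E.
  apply: (cl h H w1 w2) => //; first by rewrite le_max lexx.
  - by rewrite ge_min lexx.
  - by rewrite w1r w2r; lra.
have D3 : (nd h (s, p'.2) p' <= (2 * d)%:E)%E.
  rewrite [p' in nd h _ p']surjective_pairing.
  apply: (le_trans (null_dist_vertical sigma lt_t0_t1 h p'.2 sM Mp')).
  rewrite lee_fin; move: sp dp; rewrite !ler_norml; lra.
apply: le_trans (null_dist_triangle _ _ _ (s, p.2) _ _) _.
have -> : 3 * d + m * H = d + (m * H + 2 * d) by ring.
rewrite EFinD; apply: leeD => //.
apply: le_trans (null_dist_triangle _ _ _ (s, p'.2) _ _) _.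
by rewrite EFinD; apply: leeD.
Qed.

Hypothesis S_compact : compact [set: S].

(** Compactness of [[t0, t1] * S], covered by products of time balls with horizontally close
    neighbourhoods. Closeness is recorded in both orders, for entering and for leaving the net. *)
Lemma finite_net (m d : R) : 0 < m -> 0 < d -> exists s : seq (R * S),
  (forall p, p \in s -> M p) /\
  forall p, M p -> exists2 p', p' \in s &
    [/\ close m p.2 p'.2, close m p'.2 p.2 & `|p.1 - p'.1| <= d].
Proof.
move=> m0 d0.
have cM : compact (M : set (R * S)).
  have -> : (M : set (R * S)) = `[t0, t1] `*` [set: S].
    by apply/seteqP; split=> -[t x] /=; rewrite /spacetime /= in_itv /= => // -[].
  by apply: compact_setX => //; exact: segment_compact.
have UP x0 : {U : set S | open_nbhs x0 U /\
    forall x x', U x -> U x' -> close m x x'}.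
  apply: cid; have [U oU cU] := nbhs_horizontally_close sigma t0 t1 x0 m0.
  by exists U.
pose F (p : R * S) := ball p.1 d `*` sval (UP p.2).
(* [compact_cover] is only available on pointed spaces, hence the near-covering
   formulation, with the filter of sets of points ordered by inclusion. *)
pose G := filter_from [set s : seq (R * S) | forall p, p \in s -> M p]
  (fun s => [set s' : seq (R * S) | {subset s <= s'}]).
have FG : Filter G.
  apply: filter_from_filter; first by exists [::].
  move=> s s' sM s'M; exists (s ++ s').
    by move=> p; rewrite mem_cat => /orP[/sM|/s'M].
  by move=> s'' H; split=> p ps; apply: H; rewrite mem_cat ps ?orbT.
pose P (s : seq (R * S)) (p : R * S) := exists2 p', p' \in s &
    [/\ close m p.2 p'.2, close m p'.2 p.2 & `|p.1 - p'.1| <= d].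
have : G [set s | M `<=` P s].
  have /compact_near_coveringP cM' := cM.
  apply: (cM' _ G P FG) => p Mp.
  exists (F p, [set s : seq (R * S) | p \in s]) => /=.
    split; last first.
      exists [:: p] => [p'|s H] /=; first by rewrite inE => /eqP ->.
      by apply: H; rewrite inE.
    exists (ball p.1 d, sval (UP p.2)) => //; split; first exact: nbhsx_ballx.
    by apply: open_nbhs_nbhs; case: (svalP (UP p.2)).
  move=> [p' s] /= [[b U] ps]; exists p => //.
  have [[_ Up] cU] := svalP (UP p.2).
  split; [exact: cU|exact: cU|].
  by move: b; rewrite -ball_normE /= distrC => /ltW.
by move=> [s sM H]; exists s; split=> // p Mp; exact: (H s).
Qed.

Hypothesis S_connected : connected [set: S].
Context (h : R -> R).
Hypothesis h_pos : forall t, t0 <= t <= t1 -> 0 < h t.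
Hypothesis h_cont : {within `[t0, t1], continuous h}.

Lemma null_dist_lty (p q : R * S) : M p -> M q -> (nd h p q < +oo)%E.
Proof.
move=> Mp Mq.
have t0M : t0 <= t0 <= t1 by rewrite lexx ltW.
pose B := [set y | (nd h (t0, p.2) (t0, y) < +oo)%E].
have loc x0 : exists2 U, open_nbhs x0 U & forall x y, U x -> U y ->
    (nd h (t0, x) (t0, y) < +oo)%E.
  have [U oU cU] := nbhs_horizontally_close sigma t0 t1 x0 ltr01.
  exists U => // x y Ux Uy.
  have := @null_dist_close h (h t0 + 1) 0 1 (t0, x) (t0, y) h_pos h_cont t0M t0M
    (cU _ _ Ux Uy).
  rewrite /= subrr normr0 => /(_ (lexx _)) H.
  apply: le_lt_trans (H _) (ltry _).
  by exists t0; rewrite subrr normr0 ltrDl.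
have tri x y z : (nd h x y < +oo)%E -> (nd h y z < +oo)%E -> (nd h x z < +oo)%E.
  move=> xy yz; apply: le_lt_trans (null_dist_triangle _ _ _ y _ _) _.
  exact: lte_add_pinfty.
(* The points at finite distance from [p.2] at time [t0] form a nonempty open and closed set. *)
have BT : B = [set: S].
  apply: S_connected.
  - have [U [oU Up] cU] := loc p.2; exists p.2; exact: cU.
  - exists B; last by rewrite setTI.
    rewrite openE => y By; have [U oU cU] := loc y.
    have Uy : U y by case: oU.
    apply: filterS (open_nbhs_nbhs oU) => z Uz.
    exact: tri By (cU _ _ Uy Uz).
  - exists B; last by rewrite setTI.
    move=> y yB; have [U oU cU] := loc y.
    have [z [Bz Uz]] := yB U (open_nbhs_nbhs oU).
    by apply: tri Bz (cU _ _ Uz _); case: oU.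
have Bq : B q.2 by rewrite BT.
apply: (tri _ (t0, p.2)).
  rewrite [p in nd h p _]surjective_pairing.
  exact: le_lt_trans (null_dist_vertical sigma lt_t0_t1 h p.2 Mp t0M) (ltry _).
apply: tri Bq _.
rewrite [q in nd h _ q]surjective_pairing.
exact: le_lt_trans (null_dist_vertical sigma lt_t0_t1 h q.2 t0M Mq) (ltry _).
Qed.

(** Every point is within a fixed distance of a finite net, and the finitely many distances between
    net points are finite. *)
Lemma null_dist_bounded :
  exists D, forall p q, M p -> M q -> (nd h p q <= D%:E)%E.
Proof.
have [s [sM sN]] := finite_net ltr01 ltr01.
have [c cM cmax] := EVT_max (ltW lt_t0_t1) h_cont.
have near_net p p' : M p -> M p' -> close 1 p.2 p'.2 -> `|p.1 - p'.1| <= 1 ->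
    (nd h p p' <= (3 * 1 + 1 * (h c + 1))%:E)%E.
  move=> Mp Mp' cl pp'; apply: null_dist_close => //.
  exists p.1; rewrite subrr normr0; split=> //.
  by rewrite ltr_pwDr// cmax// in_itv.
have : \forall D \near +oo%R, forall pq, pq \in [seq (p, q) | p <- s, q <- s] ->
    (nd h pq.1 pq.2 <= D%:E)%E.
  apply: filter_forall_seq => _ /allpairsP[[p q] [/= ps qs ->]] /=.
  have := null_dist_lty (sM _ ps) (sM _ qs).
  have := null_dist_ge0 (warped_metric sigma h) M fst p q.
  case: (nd h p q) => [r _ _|_ /=|]; [|by rewrite ltxx|by []].
  by near=> D; rewrite lee_fin; near: D; apply: nbhs_pinfty_ge; exact: num_real.
move=> [D0 [_ HD]]; have {}HD : forall p q, p \in s -> q \in s ->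
    (nd h p q <= (D0 + 1)%:E)%E.
  move=> p q ps qs; have /(HD _)/(_ (p, q)) : D0 < D0 + 1 by rewrite ltrDl.
  by apply; apply/allpairsP; exists (p, q).
set K := 3 * 1 + 1 * (h c + 1) in near_net.
exists (K + (D0 + 1 + K)) => p q Mp Mq.
have [p' p's [c1 _ pp']] := sN _ Mp; have [q' q's [_ c2 qq']] := sN _ Mq.
apply: le_trans (null_dist_triangle _ _ _ p' _ _) _.
rewrite EFinD; apply: leeD; first by apply: near_net => //; exact: sM.
apply: le_trans (null_dist_triangle _ _ _ q' _ _) _.
rewrite EFinD; apply: leeD; first exact: HD.
by apply: near_net => //; [exact: sM|rewrite distrC].
Unshelve. all: by end_near. Qed.

End Compactness.

(** * Uniform convergence of the null distances *)

Lemma cvg_ereal_sup0 (R : realType) (F : nat -> set (\bar R)) :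
  (forall e : R, 0 < e -> \forall j \near \oo,
     F j !=set0 /\ forall x, F j x -> (0 <= x <= e%:E)%E) ->
  (fun j => ereal_sup (F j)) @ \oo --> 0%E.
Proof.
move=> H.
have H' (e : R) : 0 < e ->
    \forall j \near \oo, (0 <= ereal_sup (F j) <= e%:E)%E.
  move=> e0; near=> j; have [[x Fx] Fe] : F j !=set0 /\
      forall x, F j x -> (0 <= x <= e%:E)%E by near: j; exact: H.
  (* An element of [F j] bounds the supremum below by 0; for an empty set it would be -oo. *)
  apply/andP; split.
    by apply: (@le_trans _ _ x); [case/andP: (Fe _ Fx)|exact: ereal_sup_ubound].
  by apply: ge_ereal_sup => y /Fe/andP[].
have fin e j : (0 <= ereal_sup (F j) <= e%:E)%E -> ereal_sup (F j) \is a fin_num.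
  by move=> /andP[u0 ue]; rewrite ge0_fin_numE// (le_lt_trans ue)// ltry.
apply/fine_cvgP; split.
  by apply: filterS (H' 1 ltr01) => j; exact: fin.
apply/cvgrPdist_le => e e0; near=> j.
have ue : (0 <= ereal_sup (F j) <= e%:E)%E by near: j; exact: H'.
have := ue; rewrite -(fineK (fin _ _ ue)) !lee_fin => /andP[u0 u1].
by rewrite sub0r normrN ger0_norm.
Unshelve. all: by end_near. Qed.

Theorem theorem1p3 (R : realType) (n : nat) (S : topologicalType)
    (A : smooth_manifold R n S) (sigma : riemannian_metric A)
    (S_nonempty : [set: S] !=set0)
    (S_compact : compact [set: S])
    (S_connected : connected [set: S])
    (t0 t1 : R) (lt_t0_t1 : t0 < t1)
    (f : nat -> R -> R) (f_oo : R -> R)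
    (f_pos : forall j t, (0 < j)%N -> t0 <= t <= t1 -> 0 < f j t)
    (f_oo_pos : forall t, t0 <= t <= t1 -> 0 < f_oo t)
    (f_cont : forall j, (0 < j)%N -> {within `[t0, t1], continuous (f j)})
    (f_oo_cont : {within `[t0, t1], continuous f_oo})
    (f_L1 : (fun j => \int[lebesgue_measure]_(t in `[t0, t1])
                        (`|f j t - f_oo t|%:E))%E @ \oo --> 0%E)
    (f_lower : forall j t, (0 < j)%N -> t0 <= t <= t1 ->
                 (1 - j%:R^-1) * f_oo t <= f j t) :
  let M := @spacetime R S t0 t1 in
  let d (h : R -> R) := null_dist (warped_metric sigma h) M fst in
  (fun j => ereal_sup [set `|d (f j) p q - d f_oo p q|%E | p in M & q in M])
    @ \oo --> 0%E.
Proof.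
move=> M d.
pose mu := @lebesgue_measure R.
have M0 : M !=set0 by case: S_nonempty => x _; exists (t0, x); rewrite /M /spacetime /= lexx ltW.
have [c cM cmax] := EVT_max (ltW lt_t0_t1) f_oo_cont.
have [b bM bmin] := EVT_min (ltW lt_t0_t1) f_oo_cont.
have fb0 : 0 < f_oo b by apply: f_oo_pos; move: bM; rewrite in_itv.
have f_ge t : t0 <= t <= t1 -> f_oo b <= f_oo t by move=> tM; apply: bmin; rewrite in_itv.
have f_le t : t0 <= t <= t1 -> f_oo t <= f_oo c by move=> tM; apply: cmax; rewrite in_itv.
pose C := (f_oo b)^-1.
have C0 : 0 < C by rewrite invr_gt0.
pose H := f_oo c + 1.
have H0 : 0 < H by rewrite /H; have := f_oo_pos c; move: cM; rewrite in_itv /= => -> /(_ isT); lra.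
pose g j (t : R) : R := `|f j t - f_oo t|.
have g0 j t : 0 <= g j t by exact: normr_ge0.
have gc j : (0 < j)%N -> {within `[t0, t1], continuous (g j)}.
  by move=> j0 x; apply: cvg_norm; apply: cvgB; [exact: f_cont|exact: f_oo_cont].
pose Ig j t := (\int[mu]_(x in `[t0, t]) g j x)%R.
have IgP j : (0 < j)%N -> primitive_above t0 t1 (g j) (Ig j).
  by move=> j0; apply: primitive_above_Rintegral; exact: gc.
pose I j := Ig j t1.
have Icvg : I @ \oo --> 0 by have /fine_cvgP[_] := f_L1.
have Ig_ge0 j t : 0 <= Ig j t by apply: Rintegral_ge0 => x _; exact: normr_ge0.
have Ig_mono j u v : (0 < j)%N -> t0 <= u -> u <= v -> v <= t1 -> Ig j u <= Ig j v.
  move=> j0 tu uv vt; rewrite -subr_ge0 -[leLHS](mul0r (v - u)).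
  by apply: IgP => // r _; exact: normr_ge0.
have Ismall (e : R) : 0 < e -> \forall j \near \oo, (0 < j)%N /\ I j < e.
  move=> e0; near=> j; split; first by near: j; exists 1%N.
  apply: le_lt_trans (ler_norm _) _; rewrite -normrN -[X in `|X|]add0r.
  by near: j; exact: (cvgrPdist_lt _ _).1 Icvg e e0.
have step_j j p q : (0 < j)%N ->
    causal_step (warped_metric sigma f_oo) M p q ->
    (d (f j) p q <= (1 * `|q.1 - p.1| + C * I j)%:E)%E.
  move=> j0 st.
  have pM : t0 <= p.1 <= t1 /\ t0 <= q.1 <= t1.
    case: st => [be [x [y [xy Mb _ <- <-]]]].
    by split; apply: Mb; rewrite lexx ltW.
  have [pM1 qM1] := pM.
  (* As [C * f_oo >= 1], [phi t * f_oo t >= f_oo t + g j t >= f j t]. The increment of [Phi] exceeds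
     that of time by at most [C * I j]. *)
  pose phi t := 1 + C * g j t; pose Phi t := t + C * Ig j t.
  have := @causal_step_dist R n S A sigma t0 t1 lt_t0_t1 (f j) f_oo phi Phi.
  move=> /(_ (fun t => f_pos j t j0) (f_cont j j0)) K.
  apply: (le_trans (K _ _ _ _ _ _ st)).
  - move=> x; apply: cvgD; first exact: cvg_cst.
    apply: cvgM; first exact: cvg_cst.
    exact: (gc j j0 x).
  - by move=> t _; rewrite /phi lerDl; apply: mulr_ge0 => //; exact: ltW.
  - move=> m u v tu uv vt mphi.
    have := IgP j j0 ((m - 1) / C) u v tu uv vt.
    have mg r : u <= r <= v -> (m - 1) / C <= g j r.
      by move=> /mphi; rewrite /phi ler_pdivrMr// mulrC; lra.
    move=> /(_ mg) /(ler_wpM2l (ltW C0)).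
    rewrite mulrA mulrCA divff ?gt_eqF// mulr1 /Phi; lra.
  - move=> t tM; have := f_ge t tM; have := ler_norm (f j t - f_oo t).
    rewrite /phi -/(g j t) => gn ft.
    have : C * f_oo b <= C * f_oo t by rewrite ler_wpM2l// ltW.
    rewrite /C mulVf ?gt_eqF// -/C => Cf.
    have : 0 <= g j t * (C * f_oo t - 1) by apply: mulr_ge0 => //; rewrite subr_ge0.
    by lra.
  - rewrite lee_fin mul1r /Phi.
    have -> : q.1 + C * Ig j q.1 - (p.1 + C * Ig j p.1) =
      (q.1 - p.1) + C * (Ig j q.1 - Ig j p.1) by ring.
    apply: (le_trans (ler_normD _ _)); rewrite lerD2l normrM gtr0_norm//.
    rewrite ler_pM2l// ler_norml.
    have [q1 q2] := andP qM1; have [p1 p2] := andP pM1.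
    have := Ig_ge0 j q.1; have := Ig_ge0 j p.1.
    have := Ig_mono j _ _ j0 q1 q2 (lexx _); have := Ig_mono j _ _ j0 p1 p2 (lexx _).
    by rewrite -/(I j); lra.
(* The constant [phi = (1 - 1/j)^-1] multiplies lengths with no additive error per piece; [j > 1]
   makes it positive. *)
have lower j p q : (1 < j)%N -> M p -> M q ->
   (((1 - j%:R^-1) * fine (d f_oo p q))%:E <= d (f j) p q)%E.
  move=> j1 Mp Mq; have j0 : (0 < j)%N by exact: ltnW.
  pose k : R := 1 - j%:R^-1.
  have jV : 0 < j%:R^-1 :> R by rewrite invr_gt0 ltr0n.
  have k0 : 0 < k by rewrite subr_gt0 invf_lt1 ?ltr0n// ltr1n.
  apply: le_null_dist => l /causal_chain_dist[N /(_ (warped_metric sigma f_oo) k^-1 0)].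
  rewrite mulr0 addr0 => K.
  have /K : forall p' q', causal_step (warped_metric sigma (f j)) M p' q' ->
      (d f_oo p' q' <= (k^-1 * `|q'.1 - p'.1| + 0)%:E)%E.
    move=> p' q' st.
    apply: (le_trans (@causal_step_dist R n S A sigma t0 t1 lt_t0_t1 f_oo (f j)
      (cst k^-1) (fun t => k^-1 * t) f_oo_pos f_oo_cont _ _ _ _ _ _ st)).
    - by move=> x; exact: cvg_cst.
    - by move=> t _; rewrite invf_ge1// /k; lra.
    - move=> m u v tu uv vt mk; rewrite -mulrBr ler_wpM2r ?subr_ge0//.
      by apply: (mk u); rewrite lexx.
    - by move=> t tM; rewrite mulrC ler_pdivlMr// mulrC; exact: f_lower.
    - by rewrite -mulrBr normrM gtr0_norm ?invr_gt0// addr0.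
  have := null_dist_lty sigma lt_t0_t1 S_connected f_oo_pos f_oo_cont Mp Mq.
  have := null_dist_ge0 (warped_metric sigma f_oo) M fst p q.
  rewrite -/(d f_oo p q); case: (d f_oo p q) => [r| |] //= _ _.
  by rewrite !lee_fin mulrC ler_pdivlMr// mulrC.
have H_oo t : t0 <= t <= t1 -> f_oo t < H by move=> /f_le; rewrite /H; lra.
(* Otherwise [|f j - f_oo| >= 1] on an interval of length [e]. *)
have level j e t : (0 < j)%N -> e <= (t1 - t0) / 2 -> I j < e ->
    t0 <= t <= t1 -> exists s, [/\ t0 <= s <= t1, `|s - t| <= e & f j s < H].
  move=> j0 et Ie tM; apply: contrapT => /forallNP noS.
  have e0 : 0 < e by apply: le_lt_trans Ie; exact: Ig_ge0.
  (* Since [e] is at most half of [t1 - t0], an interval of length [e] that starts or ends at [t]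
     fits into [[t0, t1]]. *)
  have [u [tu uvM ute]] : exists u, [/\ t0 <= u, u + e <= t1 &
      forall r, u <= r <= u + e -> `|r - t| <= e].
    have [te|te] := leP (t + e) t1.
      exists t; split=> // [|r rt]; first lra.
      by rewrite ler_norml; lra.
    by exists (t - e); split=> [||r rt]; [lra|lra|rewrite ler_norml; lra].
  have g1 r : u <= r <= u + e -> 1 <= g j r.
    move=> ru; have rM : t0 <= r <= t1 by lra.
    have fr : H <= f j r.
      by rewrite leNgt; apply/negP => fr; apply: (noS r); split=> //; exact: ute.
    apply: le_trans (ler_norm _); have := f_le r rM.
    by move: fr; rewrite /H; lra.
  have uv : u <= u + e by lra.
  have := IgP j j0 1 u (u + e) tu uv uvM g1.
  have := Ig_mono j _ _ j0 (le_trans tu uv) uvM (lexx _).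
  by have := Ig_ge0 j u; move: Ie; rewrite -/(I j); lra.
have upper (e : R) : 0 < e -> \forall j \near \oo, forall p q, M p -> M q ->
    (d (f j) p q <= d f_oo p q + e%:E)%E.
  (* 17 = 4 * 4 + 1: four passages between a point and the net, two for each metric, cost [4 * e']
     each, and the comparison on net pairs costs [e']. *)
  move=> e0; pose e' := e / 17; have e'0 : 0 < e' by rewrite /e'; lra.
  (* The second bound is the one required by [level]; the first, with closeness [e' / H], gives
     [3 * dl + e' <= 4 * e']. *)
  pose dl := Num.min e' ((t1 - t0) / 2).
  have dl0 : 0 < dl by rewrite lt_min e'0 /=; lra.
  have dle : dl <= e' by rewrite ge_min lexx.
  have dlt : dl <= (t1 - t0) / 2 by rewrite ge_min lexx orbT.
  have m0 : 0 < e' / H by rewrite divr_gt0.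
  have [s [sM sN]] := finite_net sigma t0 t1 S_compact m0 dl0.
  have small (h : R -> R) (p p' : R * S) : (forall t, t0 <= t <= t1 -> 0 < h t) ->
      {within `[t0, t1], continuous h} ->
      (forall t, t0 <= t <= t1 ->
         exists s, [/\ t0 <= s <= t1, `|s - t| <= dl & h s < H]) ->
      M p -> M p' -> horizontally_close sigma t0 t1 (e' / H) p.2 p'.2 ->
      `|p.1 - p'.1| <= dl -> (d h p p' <= (4 * e')%:E)%E.
    move=> h0 hc hl Mp Mp' cl pp'.
    apply: (le_trans (null_dist_close lt_t0_t1 h0 hc Mp Mp' cl pp' (hl _ Mp))).
    by rewrite lee_fin divfK ?gt_eqF//; lra.
  have small_oo p p' := small f_oo p p' f_oo_pos f_oo_cont.
  have lev_oo t : t0 <= t <= t1 ->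
      exists s, [/\ t0 <= s <= t1, `|s - t| <= dl & f_oo s < H].
    by move=> tM; exists t; split=> //; [rewrite subrr normr0 ltW|exact: H_oo].
  have pairs : \forall j \near \oo, forall pq, pq \in [seq (p, q) | p <- s, q <- s] ->
      (d (f j) pq.1 pq.2 <= d f_oo pq.1 pq.2 + e'%:E)%E.
    apply: filter_forall_seq => _ /allpairsP[[p q] [/= ps qs ->]] /=.
    have dfin : d f_oo p q \is a fin_num.
      rewrite ge0_fin_numE ?null_dist_ge0//.
      exact: (null_dist_lty sigma lt_t0_t1 S_connected f_oo_pos f_oo_cont (sM _ ps) (sM _ qs)).
    have e2 : 0 < e' / 2 by lra.
    (* A curve within [e' / 2] of the infimum for [f_oo] is fixed before [j], hence so is [N]; the
       other [e' / 2] absorbs [N%:R * (C * I j)]. The successor of [N] avoids a division by 0. *)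
    have [_ [be [k [r [pc bp bq ->]]]] lt_l] := lb_ereal_inf_adherent e2 dfin.
    have /causal_chain_dist[N HN] := curve_chain fst pc.
    rewrite bp bq in HN.
    have NC : 0 < N.+1%:R * C by rewrite mulr_gt0.
    have e3 : 0 < e' / 2 / (N.+1%:R * C) by rewrite divr_gt0.
    near=> j.
    have [j0 Ij] : (0 < j)%N /\ I j < e' / 2 / (N.+1%:R * C) by near: j; exact: Ismall.
    apply: (le_trans (HN _ 1 (C * I j) (fun p q => step_j j p q j0))).
    rewrite mul1r EFinD; have -> : e' = e' / 2 + e' / 2 by lra.
    rewrite EFinD addeA; apply: leeD; first exact: ltW.
    rewrite lee_fin; move: Ij; rewrite ltr_pdivlMr// => /ltW; apply: le_trans.
    rewrite mulrA mulrC ler_wpM2l ?Ig_ge0// ler_wpM2r ?(ltW C0)//.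
    by rewrite ler_nat.
  near=> j => p q Mp Mq.
  have [j0 Ij] : (0 < j)%N /\ I j < dl by near: j; exact: Ismall.
  have Pj : forall pq, pq \in [seq (p, q) | p <- s, q <- s] ->
      (d (f j) pq.1 pq.2 <= d f_oo pq.1 pq.2 + e'%:E)%E by near: j; exact: pairs.
  have [p' p's [c1 c2 pp']] := sN _ Mp; have [q' q's [c3 c4 qq']] := sN _ Mq.
  have lev_j t tM := level j dl t j0 dlt Ij tM.
  have small_j x x' := small (f j) x x' (fun t => f_pos j t j0) (f_cont j j0) lev_j.
  have Mp' := sM _ p's; have Mq' := sM _ q's.
  have E1 := small_j p p' Mp Mp' c1 pp'.
  have E2 : (d (f j) q' q <= (4 * e')%:E)%E.
    by apply: small_j => //; rewrite distrC.
  have E3 : (d f_oo p' p <= (4 * e')%:E)%E.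
    by apply: small_oo => //; rewrite distrC.
  have E4 := small_oo q q' lev_oo Mq Mq' c3 qq'.
  have E5 : (d (f j) p' q' <= d f_oo p' q' + e'%:E)%E.
    by apply: (Pj (p', q')); apply/allpairsP; exists (p', q').
  have E6 : (d f_oo p' q' <= (4 * e')%:E + (d f_oo p q + (4 * e')%:E))%E.
    apply: le_trans (null_dist_triangle _ _ _ p _ _) _; apply: leeD => //.
    by apply: le_trans (null_dist_triangle _ _ _ q _ _) _; exact: leeD.
  have E7 : (d (f j) p q <= (4 * e')%:E + (((4 * e')%:E + (d f_oo p q + (4 * e')%:E)) +
      e'%:E + (4 * e')%:E))%E.
    apply: le_trans (null_dist_triangle _ _ _ p' _ _) _; apply: leeD => //.
    apply: le_trans (null_dist_triangle _ _ _ q' _ _) _; apply: leeD => //.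
    by apply: (le_trans E5); exact: leeD.
  apply: (le_trans E7).
  have := null_dist_lty sigma lt_t0_t1 S_connected f_oo_pos f_oo_cont Mp Mq.
  have := null_dist_ge0 (warped_metric sigma f_oo) M fst p q.
  rewrite -/(d f_oo p q); case: (d f_oo p q) => [r| |] //= _ _.
  by rewrite -!EFinD lee_fin /e'; lra.
have [D HD] := null_dist_bounded sigma lt_t0_t1 S_compact S_connected f_oo_pos f_oo_cont.
have D0 : 0 <= D.
  have [p Mp] := M0; rewrite -lee_fin; apply: le_trans (HD p p Mp Mp).
  exact: null_dist_ge0.
apply: cvg_ereal_sup0 => e e0; near=> j; split.
  by have [p Mp] := M0; exists `|d (f j) p p - d f_oo p p|%E; exists p => //; exists p.
move=> _ [p Mp [q Mq <-]].
have j1 : (1 < j)%N by near: j; exists 2%N.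
have U : (d (f j) p q <= d f_oo p q + e%:E)%E.
  by move: p q Mp Mq; near: j; exact: upper.
have L := lower j p q j1 Mp Mq.
(* With [d f_oo p q <= D], the factor [1 - 1/j] in [lower] costs at most [D / j]. *)
have jD : D * j%:R^-1 <= e.
  rewrite ler_pdivrMr ?ltr0n ?(ltnW j1)// mulrC -ler_pdivrMr//; apply: ltW.
  by near: j; exact: nbhs_infty_gtr.
have B : (d f_oo p q <= D%:E)%E := HD p q Mp Mq.
have G0 : (0 <= d (f j) p q)%E by exact: null_dist_ge0.
have G1 : (0 <= d f_oo p q)%E by exact: null_dist_ge0.
move: (d (f j) p q) (d f_oo p q) U L B G0 G1 => x y.
case: y => [y| |] U L B G0 G1; last 2 first.
- by move: B; rewrite leye_eq.
- by move: G1; rewrite leeNy_eq.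
case: x U L G0 => [x| |] U L G0; last 2 first.
- by move: U; rewrite -EFinD leye_eq.
- by move: G0; rewrite leeNy_eq.
move: U L B G0 G1; rewrite -!EFinD !lee_fin /= => U L B x0 y0; rewrite normr_ge0 /= ler_norml.
have jV : 0 <= j%:R^-1 :> R by rewrite invr_ge0.
have : 0 <= (D - y) * j%:R^-1 by rewrite mulr_ge0// subr_ge0.
by lra.
Unshelve. all: by end_near. Qed.
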